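(* There exist Banach almost $f$-algebras $A$ and $B$ such that both of the following hold. (i) The Riesz tensor product $A\mathbin{\bar\otimes}B$ cannot be a normed almost $f$-algebra under the natural tensor product multiplication; that is, there is no multiplication on the vector lattice $A\mathbin{\bar\otimes}B$ satisfying $(a\otimes b)(c\otimes d)=ac\otimes bd$ for all $a,c\in A$, $b,d\in B$ which, together with some lattice norm, makes $A\mathbin{\bar\otimes}B$ a normed almost $f$-algebra. (ii) The canonical copy of $A\mathbin{\bar\otimes}B$ in the Fremlin projective tensor product $A\mathbin{\widehat{\otimes}_{|\pi|}}B$ is not a subalgebra for the natural projective multiplication, i.e. it is not closed under that multiplication.
   Context: An almost $f$-algebra is a lattice-ordered associative real algebra (a vector lattice with an associative bilinear multiplication for which products of positive elements are positive) such that $f\perp g$ (i.e. $|f|\wedge|g|=0$) implies $fg=0$. A normed almost $f$-algebra is an almost $f$-algebra with a lattice norm (i.e. $|f|\le|g|$ implies $\|f\|\le\|g\|$) satisfying $\|fg\|\le\|f\|\,\|g\|$; it is a Banach almost $f$-algebra if it is norm complete. A Banach lattice algebra is a Banach lattice with an associative bilinear multiplication such that products of positive elements are positive and the norm is submultiplicative. For Archimedean vector lattices $A,B$, the Riesz (Fremlin) tensor product $A\mathbin{\bar\otimes}B$ is the Archimedean vector lattice with a Riesz bimorphism $\otimes:A\times B\to A\mathbin{\bar\otimes}B$ through which every Riesz bimorphism from $A\times B$ into an Archimedean vector lattice factors via a unique Riesz homomorphism; it contains the algebraic tensor product $A\otimes B$ and is generated by it as a vector lattice. (For $A=B=C([0,1])$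 as vector lattices it is the Riesz subspace of $C([0,1]^2)$ generated by $C([0,1])\otimes C([0,1])$.) For Banach lattices $A,B$, the Fremlin projective tensor product $A\mathbin{\widehat{\otimes}_{|\pi|}}B$ is the completion of $A\mathbin{\bar\otimes}B$ under the positive projective norm $$\|u\|_{|\pi|}=\inf\Bigl\{\sum_{i=1}^n\|x_i\|\,\|y_i\| : n\in\mathbb{N},\ x_i\in A_+,\ y_i\in B_+,\ |u|\le\sum_{i=1}^n x_i\otimes y_i\Bigr\}.$$ It is a Banach lattice containing $A\mathbin{\bar\otimes}B$ canonically as a norm-dense Riesz subspace. If $A$ and $B$ are Banach lattice algebras, it is known (Fremlin, Jaber) that $A\mathbin{\widehat{\otimes}_{|\pi|}}B$ is a Banach lattice algebra under a multiplication satisfying $(a\otimes b)(c\otimes d)=ac\otimes bd$ for all $a,c\in A$, $b,d\in B$; this is the natural projective multiplication. *)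

(* Defs.v *)
From HB Require Import structures.
From mathcomp Require Import all_boot all_order all_algebra.
From mathcomp Require Import all_classical all_reals.
From mathcomp Require Import topology normedtype.

Set Implicit Arguments.
Unset Strict Implicit.
Unset Printing Implicit Defensive.

Import Order.TTheory GRing.Theory Num.Theory.
Import numFieldNormedType.Exports.

Local Open Scope ring_scope.

(* The order is a field of its own instead of an instance of Order.Lattice:
   Num.NumDomain and Num.RealDomain combine Order.Preorder and Order.Lattice
   with algebra and norms directly, so Hierarchy Builder refuses a new
   structure joining Order.Lattice with a module or a normed module. *)
HB.mixin Record Lmodule_isVectorLattice (R : realType) V
    & GRing.Lmodule R V := {
  vle : rel V ;
  vjoin : V -> V -> V ;
  vmeet : V -> V -> V ;
  vle_refl : reflexive vle ;
  vle_anti : antisymmetric vle ;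
  vle_trans : transitive vle ;
  vjoin_le : forall x y z : V, vle (vjoin x y) z = vle x z && vle y z ;
  vle_meet : forall x y z : V, vle z (vmeet x y) = vle z x && vle z y ;
  vle_add2r : forall z x y : V, vle x y -> vle (x + z) (y + z) ;
  vle_scale_ge0 : forall (a : R) (x : V), 0 <= a -> vle 0 x -> vle 0 (a *: x)
}.

#[short(type="vectorLatticeType")]
HB.structure Definition VectorLattice (R : realType) :=
  { V of GRing.Lmodule R V & Lmodule_isVectorLattice R V }.

Notation "x <=v y" := (vle x y) (at level 70, no associativity).

Definition vabs (R : realType) (V : vectorLatticeType R) (x : V) : V :=
  vjoin x (- x).

Definition archimedean_lattice (R : realType) (V : vectorLatticeType R) : Prop :=
  forall x y : V, 0 <=v x -> (forall n : nat, x *+ n <=v y) -> x = 0.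

HB.mixin Record NormedModule_VectorLattice_hasLatticeNorm (R : realType) V
    & NormedModule R V & VectorLattice R V := {
  lattice_normP : forall x y : V, vabs x <=v vabs y -> `|x| <= `|y|
}.

#[short(type="banachLatticeType")]
HB.structure Definition BanachLattice (R : realType) :=
  { V of CompleteNormedModule R V & VectorLattice R V
       & NormedModule_VectorLattice_hasLatticeNorm R V }.

Section Algebras.
Context (R : realType) (V : vectorLatticeType R).

(* MathComp rings are unital, so the (in general non-unital) multiplication of
   a lattice-ordered algebra is a separate operation on the vector lattice. *)
Implicit Types (mul : V -> V -> V) (N : V -> R).

Definition lattice_ordered_algebra mul : Prop :=
  [/\ associative mul,
      (forall x, linear (mul x)),
      (forall y, linear (fun x => mul x y)) &
      (forall x y, 0 <=v x -> 0 <=v y -> 0 <=v mul x y)].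

Definition disjoint_elements (x y : V) : Prop := vmeet (vabs x) (vabs y) = 0.

Definition almost_f_algebra mul : Prop :=
  lattice_ordered_algebra mul /\
  (forall x y, disjoint_elements x y -> mul x y = 0).

Definition lattice_norm N : Prop :=
  [/\ (forall x, N x = 0 -> x = 0),
      (forall (a : R) x, N (a *: x) = `|a| * N x),
      (forall x y, N (x + y) <= N x + N y) &
      (forall x y, vabs x <=v vabs y -> N x <= N y)].

Definition submultiplicative mul N : Prop :=
  forall x y, N (mul x y) <= N x * N y.

Definition normed_almost_f_algebra mul N : Prop :=
  [/\ almost_f_algebra mul, lattice_norm N & submultiplicative mul N].

End Algebras.

Definition banach_almost_f_algebra (R : realType) (V : banachLatticeType R)
    (mul : V -> V -> V) : Prop :=
  normed_almost_f_algebra mul (fun x : V => `|x|).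

Definition banach_lattice_algebra (R : realType) (V : banachLatticeType R)
    (mul : V -> V -> V) : Prop :=
  lattice_ordered_algebra mul /\ submultiplicative mul (fun x : V => `|x|).

Definition riesz_homomorphism (R : realType) (V W : vectorLatticeType R)
    (f : V -> W) : Prop :=
  [/\ linear f,
      (forall x y, f (vjoin x y) = vjoin (f x) (f y)) &
      (forall x y, f (vmeet x y) = vmeet (f x) (f y))].

Definition riesz_bimorphism (R : realType) (A B C : vectorLatticeType R)
    (psi : A -> B -> C) : Prop :=
  [/\ (forall a, linear (psi a)),
      (forall b, linear (fun a => psi a b)),
      (forall a, 0 <=v a -> riesz_homomorphism (psi a)) &
      (forall b, 0 <=v b -> riesz_homomorphism (fun a => psi a b))].

(* The pair (T, tens) is determined by this universal property up to a unique
   Riesz isomorphism. *)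
Definition riesz_tensor_product (R : realType) (A B T : vectorLatticeType R)
    (tens : A -> B -> T) : Prop :=
  [/\ archimedean_lattice T,
      riesz_bimorphism tens &
      forall (C : vectorLatticeType R) (psi : A -> B -> C),
        archimedean_lattice C -> riesz_bimorphism psi ->
        exists! phi : T -> C,
          riesz_homomorphism phi /\ forall a b, phi (tens a b) = psi a b].

Definition positive_projective_norm (R : realType) (A B : banachLatticeType R)
    (T : vectorLatticeType R) (tens : A -> B -> T) (u : T) : R :=
  inf [set r : R | exists (n : nat) (x : 'I_n -> A) (y : 'I_n -> B),
    [/\ (forall i, 0 <=v x i), (forall i, 0 <=v y i),
        vabs u <=v \sum_(i < n) tens (x i) (y i) &
        r = \sum_(i < n) `|x i| * `|y i|]]%classic.

(* (P, j) is the completion of T under the positive projective norm: P is a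
   Banach lattice and j is an isometric Riesz homomorphism with dense range. *)
Definition fremlin_projective_tensor_product (R : realType)
    (A B : banachLatticeType R) (T : vectorLatticeType R) (tens : A -> B -> T)
    (P : banachLatticeType R) (j : T -> P) : Prop :=
  [/\ riesz_tensor_product tens,
      riesz_homomorphism j,
      (forall u, `|j u| = positive_projective_norm tens u) &
      dense (range j)].

Definition tensor_multiplication (A B T : Type) (mulA : A -> A -> A)
    (mulB : B -> B -> B) (tens : A -> B -> T) (mul : T -> T -> T) : Prop :=
  forall a b c d, mul (tens a b) (tens c d) = tens (mulA a c) (mulB b d).

(* Main.v *)
Require Import Defs.
From HB Require Import structures.
From mathcomp Require Import all_boot all_order all_algebra.
From mathcomp Require Import all_classical all_reals.
From mathcomp Require Import topology normedtype generic_quotient ring lra.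

(** Both algebras are spaces of summable families in which distinct units
    multiply to 0 and the square of the unit at [i] is a prescribed positive
    family of norm at most 1. Disjoint families then have product 0, so that
    these are Banach almost f-algebras ([kernel_banach_almost_f]). The Fremlin
    projective tensor product of [l1 R I] and [l1 R J] is [l1 R (I * J)]
    ([l1_fremlin_tensor]), and its natural multiplication is of the same kind:
    the square of the unit at [(i, j)] is the tensor product of the squares of
    the units at [i] and [j] ([product_kernel_mul]).

    In the first algebra the indices are divided into inputs and outputs. The
    square of the [i]-th input is the geometric sequence of ratio [2^-(i+1)] on
    the outputs from [i] on, and every other product of units is 0. The second
    algebra is [l1 R nat] with the coordinatewise product. Lattice operations
    on three elementary tensors produce a diagonal matrix with positive
    diagonal ([l1_embed_diagonal]). Its product with an elementary tensor is a
    matrix whose [l]-th column is, from row [l] on, a positive multiple of the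
    geometric sequence of ratio [2^-(l+1)] ([diagonal_mul_weight]).

    This product is not in the Riesz tensor product. The columns of an element
    of the Riesz tensor product are pieced together from finitely many vectors
    of a finite-dimensional space, the same space for all columns
    ([columns_piecewise]). If the product had this property, then for some [n]
    the pigeonhole principle would give [n + 1] of its columns that agree, on
    infinitely many rows [k], with vectors of an [n]-dimensional space. A
    linear relation between these vectors would be a nonzero polynomial with
    the roots [2^-k] for infinitely many [k]
    ([diagonal_mul_weight_notin]). So the Riesz tensor product is not closed
    under the multiplication of its completion.

    A multiplication on the Riesz tensor product itself leads to the same
    contradiction, because it must agree with the one of the completion: up to
    elementary tensors of small tails every element is a finite combination of
    tensors of units ([finite_part_approx]), and so a positive linear map is
    determined by its values on elementary tensors ([positive_maps_eq]).

    The Riesz tensor product of arbitrary vector lattices is built as the set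
    of formal lattice expressions in elementary tensors, modulo equality in all
    Archimedean targets ([riesz_tensorP]). The universal property is then
    immediate. Nothing is known a priori about equalities in this quotient, but
    the approximation by finite parts takes place in it, and it also computes
    the positive projective norm ([norm_l1_embed]). *)

Set Implicit Arguments.
Unset Strict Implicit.
Unset Printing Implicit Defensive.

Import Order.TTheory GRing.Theory Num.Theory.
Import numFieldNormedType.Exports.

Local Open Scope classical_set_scope.
Local Open Scope ring_scope.

(** * Vector lattices *)

Section VectorLatticeTheory.
Context (R : realType) (V : vectorLatticeType R).
Implicit Types (x y z t : V) (a b : R).

Lemma vle_le_trans x y z : x <=v y -> y <=v z -> x <=v z.
Proof. exact: vle_trans. Qed.

Lemma vle_addr2 z x y : x <=v y -> x + z <=v y + z.
Proof. exact: vle_add2r. Qed.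

Lemma vscale_ge0 a x : 0 <= a -> 0 <=v x -> 0 <=v a *: x.
Proof. exact: vle_scale_ge0. Qed.

Lemma vle_joinl x y : x <=v vjoin x y.
Proof. by have := vjoin_le x y (vjoin x y); rewrite vle_refl => /esym/andP[]. Qed.

Lemma vle_joinr x y : y <=v vjoin x y.
Proof. by have := vjoin_le x y (vjoin x y); rewrite vle_refl => /esym/andP[]. Qed.

Lemma vmeet_lel x y : vmeet x y <=v x.
Proof. by have := vle_meet x y (vmeet x y); rewrite vle_refl => /esym/andP[]. Qed.

Lemma vmeet_ler x y : vmeet x y <=v y.
Proof. by have := vle_meet x y (vmeet x y); rewrite vle_refl => /esym/andP[]. Qed.

Lemma vjoin_lub x y z : x <=v z -> y <=v z -> vjoin x y <=v z.
Proof. by move=> xz yz; rewrite vjoin_le xz. Qed.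

Lemma vmeet_glb x y z : z <=v x -> z <=v y -> z <=v vmeet x y.
Proof. by move=> xz yz; rewrite vle_meet xz. Qed.

Lemma vle_eq x y : x <=v y -> y <=v x -> x = y.
Proof. by move=> xy yx; apply: vle_anti; rewrite xy. Qed.

Lemma vjoinC x y : vjoin x y = vjoin y x.
Proof.
by apply: vle_eq; apply: vjoin_lub; rewrite ?vle_joinl ?vle_joinr.
Qed.

Lemma vmeetC x y : vmeet x y = vmeet y x.
Proof.
by apply: vle_eq; apply: vmeet_glb; rewrite ?vmeet_lel ?vmeet_ler.
Qed.

Lemma vjoin_idPr x y : x <=v y -> vjoin x y = y.
Proof.
by move=> xy; apply: vle_eq (vle_joinr _ _); apply: vjoin_lub (vle_refl _).
Qed.

Lemma vmeet_idPl x y : x <=v y -> vmeet x y = x.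
Proof.
by move=> xy; apply: vle_eq (vmeet_lel _ _) _; apply: vmeet_glb (vle_refl _) _.
Qed.

Lemma vle_add x y z t : x <=v y -> z <=v t -> x + z <=v y + t.
Proof.
move=> xy zt; apply: vle_le_trans (vle_addr2 z xy) _.
by rewrite ![y + _]addrC; apply: vle_addr2.
Qed.

Lemma vle_add2rE z x y : (x + z <=v y + z) = (x <=v y).
Proof.
apply/idP/idP => [h|]; last exact: vle_addr2.
by have := vle_addr2 (- z) h; rewrite !addrK.
Qed.

Lemma vle_subr_addr x y z : (x <=v y - z) = (x + z <=v y).
Proof. by rewrite -(vle_add2rE z) subrK. Qed.

Lemma vle_subl_addr x y z : (x - z <=v y) = (x <=v y + z).
Proof. by rewrite -(vle_add2rE z) subrK. Qed.

Lemma vsubr_ge0 x y : (0 <=v y - x) = (x <=v y).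
Proof. by rewrite vle_subr_addr add0r. Qed.

Lemma vle_opp x y : x <=v y -> - y <=v - x.
Proof. by rewrite -vsubr_ge0 -[- y <=v _]vsubr_ge0 opprK addrC. Qed.

Lemma vadd_ge0 x y : 0 <=v x -> 0 <=v y -> 0 <=v x + y.
Proof. by move=> x0 y0; rewrite -[0]addr0; apply: vle_add. Qed.

Lemma vle_scale a x y : 0 <= a -> x <=v y -> a *: x <=v a *: y.
Proof.
move=> a0; rewrite -vsubr_ge0 => xy; rewrite -vsubr_ge0 -scalerBr.
exact: vscale_ge0.
Qed.

Lemma vle_scale_le a b x : 0 <=v x -> a <= b -> a *: x <=v b *: x.
Proof.
move=> x0 ab; rewrite -vsubr_ge0 -scalerBl.
by apply: vscale_ge0 => //; rewrite subr_ge0.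
Qed.

Lemma vle_sum (I : Type) (r : seq I) (F G : I -> V) :
  (forall i, F i <=v G i) -> \sum_(i <- r) F i <=v \sum_(i <- r) G i.
Proof.
move=> FG; elim: r => [|i r IH]; first by rewrite !big_nil vle_refl.
by rewrite !big_cons; apply: vle_add.
Qed.

Lemma vsum_ge0 (I : Type) (r : seq I) (F : I -> V) :
  (forall i, 0 <=v F i) -> 0 <=v \sum_(i <- r) F i.
Proof.
by move=> F0; elim: r => [|i r IH]; rewrite ?big_nil ?vle_refl// big_cons vadd_ge0.
Qed.

Lemma vjoin_addr x y z : vjoin (x + z) (y + z) = vjoin x y + z.
Proof.
apply: vle_eq; first by apply: vjoin_lub; apply: vle_add2r; rewrite ?vle_joinl ?vle_joinr.
by rewrite -vle_subr_addr; apply: vjoin_lub; rewrite vle_subr_addr ?vle_joinl ?vle_joinr.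
Qed.

Lemma vmeet_addr x y z : vmeet (x + z) (y + z) = vmeet x y + z.
Proof.
apply: vle_eq; last by apply: vmeet_glb; apply: vle_add2r; rewrite ?vmeet_lel ?vmeet_ler.
by rewrite -vle_subl_addr; apply: vmeet_glb; rewrite vle_subl_addr ?vmeet_lel ?vmeet_ler.
Qed.

Lemma vmeet_opp x y : vmeet x y = - vjoin (- x) (- y).
Proof.
apply: vle_eq.
  rewrite -[vmeet x y]opprK; apply: vle_opp; apply: vjoin_lub; apply: vle_opp;
  by rewrite ?vmeet_lel ?vmeet_ler.
apply: vmeet_glb; first rewrite -[X in _ <=v X]opprK.
  by apply: vle_opp; apply: vle_joinl.
by rewrite -[X in _ <=v X]opprK; apply: vle_opp; apply: vle_joinr.
Qed.

Lemma vjoinE x y : vjoin x y = vjoin (x - y) 0 + y.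
Proof. by rewrite -vjoin_addr subrK add0r. Qed.

Lemma vjoin_sub0 x y : vjoin (x - y) 0 = x - vmeet x y.
Proof.
by rewrite vmeet_opp opprK [RHS]addrC -vjoin_addr addNr vjoinC (addrC (- y)).
Qed.

Lemma vle_abs x : x <=v vabs x.
Proof. exact: vle_joinl. Qed.

Lemma vle_absN x : - x <=v vabs x.
Proof. exact: vle_joinr. Qed.

Lemma vabs_le x y : x <=v y -> - x <=v y -> vabs x <=v y.
Proof. exact: vjoin_lub. Qed.

Lemma vabsN x : vabs (- x) = vabs x.
Proof. by rewrite /vabs opprK vjoinC. Qed.

Lemma vabs_ge0 x : 0 <=v vabs x.
Proof.
have h : 0 <=v 2%:R *: vabs x.
  rewrite scaler_nat mulr2n -[X in X <=v _](subrr x).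
  by apply: vle_add; [exact: vle_abs | exact: vle_absN].
have := vscale_ge0 (_ : 0 <= 2%:R^-1 :> R) h.
by rewrite scalerA mulVf ?pnatr_eq0// scale1r; apply; rewrite invr_ge0 ler0n.
Qed.

Lemma vabs_ge0_id x : 0 <=v x -> vabs x = x.
Proof.
move=> x0; apply: vle_eq; last exact: vle_abs.
apply: vabs_le; first exact: vle_refl.
by apply: (vle_le_trans _ x0); rewrite -oppr0; apply: vle_opp.
Qed.

Lemma vabs_add x y : vabs (x + y) <=v vabs x + vabs y.
Proof.
apply: vabs_le; first by apply: vle_add; apply: vle_abs.
by rewrite opprD; apply: vle_add; apply: vle_absN.
Qed.

Lemma vabs_sum (I : Type) (r : seq I) (F : I -> V) :
  vabs (\sum_(i <- r) F i) <=v \sum_(i <- r) vabs (F i).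
Proof.
elim: r => [|i r IH]; first by rewrite !big_nil vabs_ge0_id vle_refl.
by rewrite !big_cons; apply: vle_le_trans (vabs_add _ _) _; apply: vle_add (vle_refl _) IH.
Qed.

Lemma vabs_scale a x : vabs (a *: x) <=v `|a| *: vabs x.
Proof.
apply: vabs_le; case: (ger0P a) => a0.
- by apply: vle_scale => //; exact: vle_abs.
- rewrite -[X in X <=v _]opprK -scaleNr -scalerN.
  by apply: vle_scale; [rewrite oppr_ge0 ltW | exact: vle_absN].
- by rewrite -scalerN; apply: vle_scale => //; exact: vle_absN.
- by rewrite -scaleNr; apply: vle_scale; [rewrite oppr_ge0 ltW | exact: vle_abs].
Qed.

Lemma vabs_distC x y : vabs (x - y) = vabs (y - x).
Proof. by rewrite -vabsN opprB. Qed.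

(** Lattice operations are Lipschitz for the absolute value. This is what lets
    an approximation of the arguments pass through a lattice expression. *)
Lemma vabs_join_sub x y z t :
  vabs (vjoin x y - vjoin z t) <=v vabs (x - z) + vabs (y - t).
Proof.
have aux (p q r s : V) : vjoin p q - vjoin r s <=v vabs (p - r) + vabs (q - s).
  have le1 (p' r' : V) : p' <=v vabs (p' - r') + r' by rewrite -vle_subl_addr vle_abs.
  rewrite vle_subl_addr; apply: vjoin_lub.
    apply: (vle_le_trans (le1 p r)); apply: vle_add; last exact: vle_joinl.
    by rewrite -vsubr_ge0 addrAC subrr add0r vabs_ge0.
  apply: (vle_le_trans (le1 q s)); apply: vle_add; last exact: vle_joinr.
  by rewrite -vsubr_ge0 addrK vabs_ge0.
apply: vabs_le; first exact: aux.
by rewrite opprB (vabs_distC x) (vabs_distC y).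
Qed.

Lemma vabs_meet_sub x y z t :
  vabs (vmeet x y - vmeet z t) <=v vabs (x - z) + vabs (y - t).
Proof.
rewrite !vmeet_opp opprK addrC; apply: vle_le_trans (vabs_join_sub _ _ _ _) _.
by rewrite !opprK !(addrC (- z)) !(addrC (- t)) vle_refl.
Qed.

Lemma vmeet_le2 x y z t : x <=v z -> y <=v t -> vmeet x y <=v vmeet z t.
Proof.
move=> xz yt; apply: vmeet_glb; first exact: vle_le_trans (vmeet_lel _ _) xz.
exact: vle_le_trans (vmeet_ler _ _) yt.
Qed.

Lemma vmeet_ge0 x y : 0 <=v x -> 0 <=v y -> 0 <=v vmeet x y.
Proof. exact: vmeet_glb. Qed.

(** Distributivity of meet over addition holds as an inequality; it makes
    disjointness from [x] stable under sums. *)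
Lemma vmeet_add_le x y z : 0 <=v x -> 0 <=v y -> 0 <=v z ->
  vmeet x (y + z) <=v vmeet x y + vmeet x z.
Proof.
move=> x0 y0 z0; rewrite -vmeet_addr; apply: vmeet_glb.
  apply: (vle_le_trans (vmeet_lel _ _)).
  by rewrite addrC -vle_subl_addr subrr vmeet_ge0.
rewrite [X in _ <=v X]addrC -vmeet_addr [z + y]addrC.
apply: vmeet_glb; last exact: vmeet_ler.
apply: (vle_le_trans (vmeet_lel _ _)).
by rewrite addrC -vle_subl_addr subrr.
Qed.

Lemma vmeet_sum_eq0 (I : Type) (r : seq I) (F : I -> V) x :
  0 <=v x -> (forall i, 0 <=v F i) -> (forall i, vmeet x (F i) = 0) ->
  vmeet x (\sum_(i <- r) F i) = 0.
Proof.
move=> x0 F0 xF; elim: r => [|i r IH].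
  by rewrite big_nil vmeetC vmeet_idPl.
rewrite big_cons; apply: vle_eq; last by rewrite vmeet_ge0 ?vadd_ge0 ?vsum_ge0.
by apply: vle_le_trans (vmeet_add_le _ _ _) _; rewrite ?vsum_ge0// xF IH addr0 vle_refl.
Qed.

(** Both multiples lie below the multiples by [a + b + 1], and scaling by one
    common positive number commutes with the meet. *)
Lemma vmeet_scale_eq0 a b x y : 0 <= a -> 0 <= b -> 0 <=v x -> 0 <=v y ->
  vmeet x y = 0 -> vmeet (a *: x) (b *: y) = 0.
Proof.
move=> a0 b0 x0 y0 xy; pose c := a + b + 1.
have c0 : 0 < c by rewrite ltr_wpDl ?addr_ge0.
apply: vle_eq; last by rewrite vmeet_ge0 ?vscale_ge0.
set m := vmeet _ _.
have -> : m = c *: (c^-1 *: m) by rewrite scalerA divff ?gt_eqF// scale1r.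
rewrite -(scaler0 _ c); apply: vle_scale; first exact: ltW.
rewrite -xy; apply: vmeet_glb.
  have -> : x = c^-1 *: (c *: x) by rewrite scalerA mulVf ?gt_eqF// scale1r.
  apply: vle_scale; first by rewrite invr_ge0 ltW.
  apply: vle_le_trans (vmeet_lel _ _) (vle_scale_le x0 _).
  by rewrite /c -addrA lerDl addr_ge0.
have -> : y = c^-1 *: (c *: y) by rewrite scalerA mulVf ?gt_eqF// scale1r.
apply: vle_scale; first by rewrite invr_ge0 ltW.
apply: vle_le_trans (vmeet_ler _ _) (vle_scale_le y0 _).
by rewrite /c addrAC lerDr addr_ge0.
Qed.

End VectorLatticeTheory.

(** * Spaces of summable families as Banach lattices *)

Section L1.
Context (R : realType) (I : eqType).
Implicit Types (f g : I -> R) (s : seq I).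

Definition abs_summable f : Prop :=
  exists M : R, forall s, uniq s -> \sum_(i <- s) `|f i| <= M.

Definition l1_pred : {pred I -> R} := [pred f | `[< abs_summable f >]].

Lemma l1_predP f : reflect (abs_summable f) (f \in l1_pred).
Proof. exact: asboolP. Qed.

Lemma l1_submod_closed : submod_closed l1_pred.
Proof.
split=> [|a f g /l1_predP[M fM] /l1_predP[N gN]]; apply/l1_predP.
  by exists 0 => s _; rewrite big1// => i _; rewrite normr0.
exists (`|a| * M + N) => s us.
apply: (@le_trans _ _ (`|a| * \sum_(i <- s) `|f i| + \sum_(i <- s) `|g i|)).
  rewrite mulr_sumr -big_split/=; apply: ler_sum => i _.
  by rewrite (le_trans (ler_normD _ _))// normrM.
by rewrite lerD ?gN// ler_wpM2l// fM.
Qed.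

HB.instance Definition _ :=
  GRing.isSubmodClosed.Build R (I -> R) l1_pred l1_submod_closed.

Record l1 := L1 { l1_fun :> I -> R; l1_funP : l1_fun \in l1_pred }.

#[global] Arguments l1_fun : simpl never.

HB.instance Definition _ := [isSub for l1_fun].
HB.instance Definition _ := [Choice of l1 by <:].
HB.instance Definition _ := [SubChoice_isSubLmodule of l1 by <:].

Implicit Types x y : l1.

Lemma l1P x y : (forall i, x i = y i) -> x = y.
Proof. by move=> xy; apply/val_inj/funext. Qed.

Lemma l1D x y i : (x + y) i = x i + y i. Proof. by []. Qed.
Lemma l1N x i : (- x) i = - x i. Proof. by []. Qed.
Lemma l1B x y i : (x - y) i = x i - y i. Proof. by []. Qed.
Lemma l1Z (a : R) x i : (a *: x) i = a * x i. Proof. by []. Qed.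
Lemma l10 i : (0 : l1) i = 0. Proof. by []. Qed.

Definition l1E := (l1B, l1D, l1N, l1Z, l10).

(** The supremum is taken over duplicate-free lists of indices, so that only
    finite sums occur and the index type can be arbitrary. *)
Definition l1_norm x : R :=
  sup [set r | exists2 s, uniq s & r = \sum_(i <- s) `|x i|]%classic.

Lemma l1_norm_ge x s : uniq s -> \sum_(i <- s) `|x i| <= l1_norm x.
Proof.
move=> us; apply: ub_le_sup; last by exists s.
by have /l1_predP[M xM] := l1_funP x; exists M => _ [t ut ->]; exact: xM.
Qed.

Lemma l1_norm_le x (M : R) :
  (forall s, uniq s -> \sum_(i <- s) `|x i| <= M) -> l1_norm x <= M.
Proof.
move=> xM; apply: ge_sup; first by exists 0, [::]; rewrite ?big_nil.
by move=> _ [s us ->]; exact: xM.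
Qed.

Lemma l1_coord_le x i : `|x i| <= l1_norm x.
Proof. by have := @l1_norm_ge x [:: i] isT; rewrite big_seq1. Qed.

Lemma l1_norm_ge0 x : 0 <= l1_norm x.
Proof. by have := @l1_norm_ge x [::] isT; rewrite big_nil. Qed.

Lemma l1_normD x y : l1_norm (x + y) <= l1_norm x + l1_norm y.
Proof.
apply: l1_norm_le => s us.
apply: le_trans (_ : \sum_(i <- s) (`|x i| + `|y i|) <= _).
  by apply: ler_sum => i _; exact: ler_normD.
by rewrite big_split lerD ?l1_norm_ge.
Qed.

Lemma l1_normZ (a : R) x : l1_norm (a *: x) = `|a| * l1_norm x.
Proof.
have le1 (b : R) y : l1_norm (b *: y) <= `|b| * l1_norm y.
  apply: l1_norm_le => s us.
  under eq_bigr do rewrite l1Z normrM.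
  by rewrite -mulr_sumr ler_wpM2l ?l1_norm_ge.
apply/le_anti; rewrite le1/=; have [->|a0] := eqVneq a 0.
  by rewrite normr0 mul0r l1_norm_ge0.
rewrite -ler_pdivlMl ?normr_gt0// -normfV; apply: le_trans (le1 _ _).
by rewrite scalerA mulVf// scale1r.
Qed.

Lemma l1_norm0_eq0 x : l1_norm x = 0 -> x = 0.
Proof.
move=> x0; apply: l1P => i; apply/eqP; rewrite -normr_le0 -x0.
exact: l1_coord_le.
Qed.

HB.instance Definition _ :=
  Lmodule_isNormed.Build R l1 l1_normD l1_normZ l1_norm0_eq0.

Lemma l1_normE x : `|x| = l1_norm x. Proof. by []. Qed.

(** A Cauchy filter converges in each coordinate, to [h i]. Finite partial sums
    of [`|z i - h i|] inherit the bound on [`|z - x|] valid for the [x] in a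
    small ball of the filter, and the norm is the supremum of these sums. *)
Lemma l1_cauchy_cvg (F : set_system l1) : ProperFilter F -> cauchy F -> cvg F.
Proof.
move=> FF /cauchyP Fc.
have Fcoord i : cvg ((fun x : l1 => x i : R^o) @ F).
  apply: cauchy_cvg; apply: cauchy_exP => e /Fc[z Fz]; exists (z i).
  apply: (@filterS l1 F _ (ball z e)) => [x|//] /=.
  rewrite -!ball_normE /=; apply: le_lt_trans.
  exact: (l1_coord_le (z - x) i).
pose h i : R := lim ((fun x : l1 => x i : R^o) @ F).
have Fh s (d : R) : 0 < d -> \forall x \near F, \sum_(i <- s) `|(x : l1) i - h i| <= d.
  elim: s d => [|i s IHs] d d0.
    by apply: filterE => x; rewrite big_nil ltW.
  have d2 : 0 < d / 2 by rewrite divr_gt0.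
  have Fi : \forall x \near F, `|(x : l1) i - h i| < d / 2.
    by have /cvgr_distC_lt /(_ _ d2) := Fcoord i.
  apply: filterS2 Fi (IHs _ d2) => x xi xs.
  rewrite big_cons [d]splitr lerD//; apply: ltW; exact: xi.
have zh (z : l1) e s : F (ball z e) -> uniq s ->
    \sum_(i <- s) `|z i - h i| <= e.
  move=> Fz us; apply/ler_addgt0Pr => d d0; near F => x.
  have xz : `|z - x| <= e.
    suff : ball z e x by rewrite -ball_normE => /ltW.
    by near: x.
  have xh : \sum_(i <- s) `|x i - h i| <= d by near: x; exact: Fh.
  apply: le_trans (lerD (le_trans (l1_norm_ge (z - x) us) xz) xh).
  rewrite -big_split/=; apply: ler_sum => i _.
  by have := ler_normD (z i - x i) (x i - h i); rewrite addrA subrK.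
have hl1 : h \in l1_pred.
  have [z Fz] := Fc _ ltr01; apply/l1_predP; exists (`|z| + 1) => s us.
  apply: le_trans (lerD (l1_norm_ge z us) (zh _ _ _ Fz us)).
  rewrite -big_split/=; apply: ler_sum => i _.
  by rewrite [X in _ + X]distrC (le_trans _ (ler_normD _ _))// addrC subrK.
apply/cvg_ex; exists (L1 hl1); apply/cvg_ballP => e e0.
have e2 : 0 < e / 2 by rewrite divr_gt0.
have [z Fz] := Fc _ e2; apply: filterS (Fz) => x.
rewrite -!ball_normE /= => zx.
have zh' : `|z - L1 hl1| <= e / 2 by apply: l1_norm_le => s us; exact: zh.
rewrite (splitr e) -(subrK z (L1 hl1)) -addrA.
by rewrite (le_lt_trans (ler_normD _ _))// ler_ltD// distrC.
Unshelve. all: by end_near. Qed.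

HB.instance Definition _ := Uniform_isComplete.Build l1 l1_cauchy_cvg.

Definition l1_le : rel l1 := fun x y => `[< forall i, x i <= y i >].

Lemma l1_leP x y : reflect (forall i, x i <= y i) (l1_le x y).
Proof. exact: asboolP. Qed.

Lemma l1_comb_pred x y (op : R -> R -> R) :
  (forall a b, `|op a b| <= `|a| + `|b|) ->
  (fun i => op (x i) (y i)) \in l1_pred.
Proof.
move=> ope; apply/l1_predP; exists (`|x| + `|y|) => s us.
apply: le_trans (lerD (l1_norm_ge x us) (l1_norm_ge y us)).
by rewrite -big_split; apply: ler_sum => i _; exact: ope.
Qed.

Lemma normr_max_le (a b : R) : `|Num.max a b| <= `|a| + `|b|.
Proof. by rewrite /Num.max; case: ifP => _; rewrite ?lerDl ?lerDr. Qed.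

Lemma normr_min_le (a b : R) : `|Num.min a b| <= `|a| + `|b|.
Proof. by rewrite /Num.min; case: ifP => _; rewrite ?lerDl ?lerDr. Qed.

Definition l1_join x y : l1 := L1 (l1_comb_pred x y normr_max_le).
Definition l1_meet x y : l1 := L1 (l1_comb_pred x y normr_min_le).

Lemma l1_joinE x y i : l1_join x y i = Num.max (x i) (y i). Proof. by []. Qed.
Lemma l1_meetE x y i : l1_meet x y i = Num.min (x i) (y i). Proof. by []. Qed.

Lemma l1_le_refl : reflexive l1_le.
Proof. by move=> x; apply/l1_leP. Qed.

Lemma l1_le_anti : antisymmetric l1_le.
Proof.
move=> x y /andP[/l1_leP xy /l1_leP yx]; apply: l1P => i.
by apply/le_anti; rewrite xy yx.
Qed.

Lemma l1_le_trans : transitive l1_le.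
Proof.
move=> y x z /l1_leP xy /l1_leP yz; apply/l1_leP => i.
exact: le_trans (xy i) (yz i).
Qed.

Lemma l1_join_le x y z : l1_le (l1_join x y) z = l1_le x z && l1_le y z.
Proof.
apply/l1_leP/andP => [h|[/l1_leP xz /l1_leP yz] i].
  by split; apply/l1_leP => i; have := h i; rewrite l1_joinE ge_max => /andP[].
by rewrite l1_joinE ge_max xz yz.
Qed.

Lemma l1_le_meet x y z : l1_le z (l1_meet x y) = l1_le z x && l1_le z y.
Proof.
apply/l1_leP/andP => [h|[/l1_leP xz /l1_leP yz] i].
  by split; apply/l1_leP => i; have := h i; rewrite l1_meetE le_min => /andP[].
by rewrite l1_meetE le_min xz yz.
Qed.

Lemma l1_le_add2r z x y : l1_le x y -> l1_le (x + z) (y + z).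
Proof. by move=> /l1_leP xy; apply/l1_leP => i; rewrite !l1E lerD2r. Qed.

Lemma l1_scale_ge0 (a : R) x : 0 <= a -> l1_le 0 x -> l1_le 0 (a *: x).
Proof.
by move=> a0 /l1_leP x0; apply/l1_leP => i; rewrite l1E mulr_ge0//; exact: x0.
Qed.

HB.instance Definition _ := Lmodule_isVectorLattice.Build R l1
  l1_le_refl l1_le_anti l1_le_trans l1_join_le l1_le_meet l1_le_add2r l1_scale_ge0.

Lemma l1_vleP x y : reflect (forall i, x i <= y i) (x <=v y).
Proof. exact: l1_leP. Qed.

Lemma l1_vjoinE x y i : vjoin x y i = Num.max (x i) (y i). Proof. by []. Qed.
Lemma l1_vmeetE x y i : vmeet x y i = Num.min (x i) (y i). Proof. by []. Qed.

Lemma l1_vabsE x i : vabs x i = `|x i|.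
Proof. by rewrite l1_vjoinE l1N maxrN. Qed.

Lemma l1_lattice_norm x y : vabs x <=v vabs y -> `|x| <= `|y|.
Proof.
move=> /l1_vleP xy; apply: l1_norm_le => s us; apply: le_trans (l1_norm_ge y us).
by apply: ler_sum => i _; rewrite -!l1_vabsE.
Qed.

HB.instance Definition _ :=
  NormedModule_VectorLattice_hasLatticeNorm.Build R l1 l1_lattice_norm.

End L1.

(** * Units, truncation and tensors of summable families *)

Lemma sum_sub_le (R : numDomainType) (I : eqType) (s t : seq I) (F : I -> R) :
  uniq s -> uniq t -> {subset s <= t} -> (forall i, 0 <= F i) ->
  \sum_(i <- s) F i <= \sum_(i <- t) F i.
Proof.
move=> us ut st F0; rewrite [leRHS](bigID (mem s))/= -[X in _ <= X + _]big_filter.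
rewrite [X in _ <= X + _](perm_big s); last first.
  apply: uniq_perm; rewrite ?filter_uniq// => i.
  by rewrite mem_filter andb_idr//; exact: st.
by rewrite lerDl sumr_ge0.
Qed.

Section Units.
Context (R : realType) (I : eqType).
Local Notation l1 := (l1 R I).
Implicit Types (x y : l1) (s : seq I).

Lemma l1_sumE (K : Type) (r : seq K) (F : K -> l1) i :
  (\sum_(k <- r) F k) i = \sum_(k <- r) F k i.
Proof. by elim: r => [|k r IH]; rewrite ?big_nil// !big_cons l1D IH. Qed.

Lemma sum_delta s (k : I) (F : I -> R) : uniq s ->
  \sum_(i <- s) F i * (k == i)%:R = if k \in s then F k else 0.
Proof.
move=> us; case: ifPn => ks.
  rewrite (bigD1_seq k)//= eqxx mulr1 big1 ?addr0// => i.
  by rewrite eq_sym => /negPf->; rewrite mulr0.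
rewrite big_seq big1// => i is_; case: eqVneq => [ki|]; last by rewrite mulr0.
by rewrite ki is_ in ks.
Qed.

Lemma l1_unit_pred (i : I) : (fun k => (k == i)%:R : R) \in @l1_pred R I.
Proof.
apply/l1_predP; exists 1 => s us.
under eq_bigr do rewrite normr_nat eq_sym -[_%:R]mul1r.
by rewrite (sum_delta i (fun=> 1))//; case: ifP.
Qed.

Definition l1_unit i : l1 := L1 (l1_unit_pred i).

Lemma l1_unitE i k : l1_unit i k = (k == i)%:R. Proof. by []. Qed.

Lemma norm_l1_unit i : `|l1_unit i| <= 1.
Proof.
apply: l1_norm_le => s us.
under eq_bigr do rewrite l1_unitE normr_nat eq_sym -[_%:R]mul1r.
by rewrite (sum_delta i (fun=> 1))//; case: ifP.
Qed.

Lemma l1_unit_ge0 i : 0 <=v l1_unit i.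
Proof. by apply/l1_vleP => k; rewrite l1_unitE ler0n. Qed.

Lemma l1_unit_disjoint i k : i != k -> vmeet (l1_unit i) (l1_unit k) = 0.
Proof.
move=> ik; apply: l1P => l; rewrite l1_vmeetE !l1_unitE.
case: (eqVneq l i) => [->|_]; first by rewrite (negPf ik) min_r.
by rewrite min_l.
Qed.

(** Written as a combination of units rather than coordinatewise, so that a
    bilinear map can be expanded on it. *)
Definition l1_trunc s x : l1 := \sum_(i <- s) x i *: l1_unit i.

Lemma l1_truncE s x k : uniq s -> l1_trunc s x k = if k \in s then x k else 0.
Proof.
move=> us; rewrite l1_sumE -(sum_delta k x us).
by apply: eq_bigr => i _; rewrite l1Z l1_unitE.
Qed.

Lemma l1_tail_abs s x : uniq s ->
  vabs (x - l1_trunc s x) = vabs x - l1_trunc s (vabs x).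
Proof.
move=> us; apply: l1P => i; rewrite l1_vabsE !l1B !l1_truncE// l1_vabsE.
by case: ifP => _; rewrite ?subrr ?normr0// !subr0.
Qed.

Lemma l1_tail_ge0 s x : uniq s -> 0 <=v x -> 0 <=v x - l1_trunc s x.
Proof.
move=> us /l1_vleP x0; apply/l1_vleP => i; rewrite l1B l1_truncE//.
by case: ifP => _; rewrite ?subrr ?subr0.
Qed.

(** A finite set [s] whose partial sum is within [e] of the norm leaves at most
    [e] for the indices outside [s]. *)
Lemma l1_tail_small x (e : R) : 0 < e ->
  exists2 s, uniq s & `|x - l1_trunc s x| <= e.
Proof.
move=> e0; have /sup_adherent : has_sup
    [set r | exists2 s, uniq s & r = \sum_(i <- s) `|x i|].
  split; first by exists 0, [::]; rewrite ?big_nil.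
  by exists `|x| => _ [s us ->]; exact: l1_norm_ge.
move=> /(_ _ e0)[_ [s us ->] xs]; exists s => //.
apply: l1_norm_le => t ut.
have -> : \sum_(i <- t) `|(x - l1_trunc s x) i| =
          \sum_(i <- t | i \notin s) `|x i|.
  rewrite (bigID (mem s))/= big1 ?add0r; last first.
    by move=> i is_; rewrite l1B l1_truncE// is_ subrr normr0.
  by apply: eq_bigr => i is_; rewrite l1B l1_truncE// (negPf is_) subr0.
have : \sum_(i <- s ++ [seq i <- t | i \notin s]) `|x i| <= `|x|.
  apply: l1_norm_ge; rewrite cat_uniq us filter_uniq// andbT /=.
  by apply/hasPn => i; rewrite mem_filter => /andP[].
rewrite big_cat big_filter /= addrC -lerBrDr; move/le_trans; apply.
by move: xs; rewrite -/(l1_norm x) -l1_normE; move/ltW; rewrite lerBlDr -lerBlDl.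
Qed.

Lemma l1_archimedean : archimedean_lattice l1.
Proof.
move=> x y /l1_vleP x0 xy; apply: l1P => i; apply/eqP; rewrite eq_le x0 andbT.
rewrite leNgt; apply/negP => xi.
have /l1_vleP/(_ i) := xy (Num.bound (`|y i| / x i)).
rewrite leNgt => /negP; apply.
have -> : (x *+ Num.bound (`|y i| / x i)) i = x i *+ Num.bound (`|y i| / x i).
  by elim: (Num.bound _) => // n IH; rewrite !mulrS l1D IH.
rewrite -mulr_natl -ltr_pdivrMr//; apply: le_lt_trans (archi_boundP _).
  by rewrite ler_pM2r ?invr_gt0// ler_norm.
by rewrite divr_ge0// ltW.
Qed.

End Units.

Section Tensor.
Context (R : realType) (I J : eqType).
Implicit Types (x : l1 R I) (y : l1 R J).

(** The pairs of [s] lie in the product of two finite sets of indices, on which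
    the sum factors. *)
Lemma sum_tensor_le (s : seq (I * J)) x y : uniq s ->
  \sum_(p <- s) `|x p.1 * y p.2| <= `|x| * `|y|.
Proof.
move=> us; pose s1 := undup [seq p.1 | p <- s]; pose s2 := undup [seq p.2 | p <- s].
apply: le_trans (_ : \sum_(p <- [seq (i, j) | i <- s1, j <- s2]) `|x p.1 * y p.2| <= _).
  apply: sum_sub_le => //; first by apply: allpairs_uniq; rewrite ?undup_uniq// => -[? ?] [].
  move=> [i j] ps; apply/allpairsP; exists (i, j); split=> //;
  by rewrite mem_undup; apply/mapP; exists (i, j).
rewrite big_allpairs /=.
under eq_bigr do under eq_bigr do rewrite normrM.
rewrite -big_distrlr/=; apply: ler_pM; rewrite ?sumr_ge0//;
by apply: l1_norm_ge; rewrite undup_uniq.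
Qed.

Lemma l1_tensor_pred x y : (fun p => x p.1 * y p.2) \in @l1_pred R (I * J)%type.
Proof. by apply/l1_predP; exists (`|x| * `|y|) => s; exact: sum_tensor_le. Qed.

Definition l1_tensor x y : l1 R (I * J)%type := L1 (l1_tensor_pred x y).

Lemma l1_tensorE x y i j : l1_tensor x y (i, j) = x i * y j. Proof. by []. Qed.

Lemma norm_l1_tensor x y : `|l1_tensor x y| <= `|x| * `|y|.
Proof. by apply: l1_norm_le => s; exact: sum_tensor_le. Qed.

Lemma l1_tensor_unit i j : l1_tensor (l1_unit R i) (l1_unit R j) = l1_unit R (i, j).
Proof.
by apply: l1P => -[k l]; rewrite l1_tensorE !l1_unitE -natrM mulnb.
Qed.

Lemma l1_tensor_bimorphism : riesz_bimorphism l1_tensor.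
Proof.
split.
- move=> x c y z; apply: l1P => -[i j].
  by rewrite !(l1E, l1_tensorE) mulrDr mulrCA.
- move=> y c x z; apply: l1P => -[i j].
  by rewrite !(l1E, l1_tensorE) mulrDl mulrA.
- move=> x /l1_vleP x0; split=> [c y z|y z|y z]; apply: l1P => -[i j].
  + by rewrite !(l1E, l1_tensorE) mulrDr mulrCA.
  + by rewrite !(l1_vjoinE, l1_tensorE) maxr_pMr// x0.
  + by rewrite !(l1_vmeetE, l1_tensorE) minr_pMr// x0.
- move=> y /l1_vleP y0; split=> [c x z|x z|x z]; apply: l1P => -[i j].
  + by rewrite !(l1E, l1_tensorE) mulrDl mulrA.
  + by rewrite !(l1_vjoinE, l1_tensorE) maxr_pMl// y0.
  + by rewrite !(l1_vmeetE, l1_tensorE) minr_pMl// y0.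
Qed.

End Tensor.

(** * Existence of Riesz tensor products *)

Section RieszTensor.

Local Open Scope quotient_scope.

Context (R : realType) (A B : vectorLatticeType R).

Inductive riesz_term : Type :=
  | TTens of A & B
  | TAdd of riesz_term & riesz_term
  | TScale of R & riesz_term
  | TJoin of riesz_term & riesz_term
  | TMeet of riesz_term & riesz_term.

HB.instance Definition _ := gen_eqMixin riesz_term.
HB.instance Definition _ := gen_choiceMixin riesz_term.

Fixpoint term_eval (C : vectorLatticeType R) (psi : A -> B -> C) t : C :=
  match t with
  | TTens a b => psi a b
  | TAdd t1 t2 => term_eval psi t1 + term_eval psi t2
  | TScale c t1 => c *: term_eval psi t1
  | TJoin t1 t2 => vjoin (term_eval psi t1) (term_eval psi t2)
  | TMeet t1 t2 => vmeet (term_eval psi t1) (term_eval psi t2)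
  end.

Definition term_equiv : rel riesz_term := fun s t =>
  `[< forall (C : vectorLatticeType R) (psi : A -> B -> C),
      archimedean_lattice C -> riesz_bimorphism psi ->
      term_eval psi s = term_eval psi t >].

Lemma term_equiv_class : equiv_class_of term_equiv.
Proof.
split=> [t|s t|t s u /asboolP st /asboolP tu]; first exact/asboolP.
  by apply/asboolP/asboolP => st C psi ? ?; rewrite st.
by apply/asboolP => C psi ? ?; rewrite st// tu.
Qed.

Canonical term_equiv_equiv := EquivRelPack term_equiv_class.

Definition riesz_tensor := {eq_quot term_equiv}.
HB.instance Definition _ := Choice.on riesz_tensor.

Definition tensor_pi (t : riesz_term) : riesz_tensor := \pi_({eq_quot term_equiv}) t.
Definition tensor_repr (u : riesz_tensor) : riesz_term := repr (u : {eq_quot term_equiv}).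

Section Eval.
Context (C : vectorLatticeType R) (psi : A -> B -> C).

Definition tensor_eval (u : riesz_tensor) : C := term_eval psi (tensor_repr u).

Hypotheses (archC : archimedean_lattice C) (bim : riesz_bimorphism psi).

Lemma tensor_evalE t : tensor_eval (tensor_pi t) = term_eval psi t.
Proof.
have : repr (\pi_({eq_quot term_equiv}) t) = t %[mod {eq_quot term_equiv}] by rewrite reprK.
by move/eqmodP/asboolP; apply.
Qed.

End Eval.

(** Every law of a vector lattice that is an identity between expressions
    follows from the same law in all targets. *)
Lemma tensor_ext (u v : riesz_tensor) :
  (forall (C : vectorLatticeType R) (psi : A -> B -> C),
     archimedean_lattice C -> riesz_bimorphism psi ->
     tensor_eval psi u = tensor_eval psi v) -> u = v.
Proof.
move=> uv; rewrite -[u](@reprK _ {eq_quot term_equiv}).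
by rewrite -[v](@reprK _ {eq_quot term_equiv}); apply/eqmodP/asboolP.
Qed.

Definition tensor_add u v := tensor_pi (TAdd (tensor_repr u) (tensor_repr v)).
Definition tensor_scale c u := tensor_pi (TScale c (tensor_repr u)).
(** The term language has no constant for zero; a bimorphism maps [(0, 0)]
    to it. *)
Definition tensor_zero := tensor_pi (TTens 0 0).
Definition tensor_opp u := tensor_scale (-1) u.
Definition tensor_join u v := tensor_pi (TJoin (tensor_repr u) (tensor_repr v)).
Definition tensor_meet u v := tensor_pi (TMeet (tensor_repr u) (tensor_repr v)).

(** An inequality holds when it holds in every Archimedean target: this makes
    the quotient Archimedean and is the order that its lattice operations
    induce. *)
Definition tensor_le u v := `[< forall (C : vectorLatticeType R) (psi : A -> B -> C),
     archimedean_lattice C -> riesz_bimorphism psi ->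
     tensor_eval psi u <=v tensor_eval psi v >].

Lemma bimorphism0 (C : vectorLatticeType R) (psi : A -> B -> C) a :
  riesz_bimorphism psi -> psi a 0 = 0.
Proof.
by case=> lin _ _ _; have := lin a (-1) 0 0; rewrite !scaleN1r !addNr.
Qed.

Section EvalOps.
Context (C : vectorLatticeType R) (psi : A -> B -> C).
Hypotheses (archC : archimedean_lattice C) (bim : riesz_bimorphism psi).

Lemma tensor_evalD u v :
  tensor_eval psi (tensor_add u v) = tensor_eval psi u + tensor_eval psi v.
Proof. exact: tensor_evalE. Qed.

Lemma tensor_evalZ c u : tensor_eval psi (tensor_scale c u) = c *: tensor_eval psi u.
Proof. exact: tensor_evalE. Qed.

Lemma tensor_eval0 : tensor_eval psi tensor_zero = 0.
Proof. by rewrite tensor_evalE//=; exact: bimorphism0. Qed.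

Lemma tensor_evalN u : tensor_eval psi (tensor_opp u) = - tensor_eval psi u.
Proof. by rewrite tensor_evalZ scaleN1r. Qed.

Lemma tensor_evalJ u v : tensor_eval psi (tensor_join u v) =
  vjoin (tensor_eval psi u) (tensor_eval psi v).
Proof. exact: tensor_evalE. Qed.

Lemma tensor_evalM u v : tensor_eval psi (tensor_meet u v) =
  vmeet (tensor_eval psi u) (tensor_eval psi v).
Proof. exact: tensor_evalE. Qed.

End EvalOps.

Lemma tensor_addA : associative tensor_add.
Proof.
by move=> u v w; apply: tensor_ext => C psi archC bim; rewrite !tensor_evalD// addrA.
Qed.

Lemma tensor_addC : commutative tensor_add.
Proof.
by move=> u v; apply: tensor_ext => C psi archC bim; rewrite !tensor_evalD// addrC.
Qed.

Lemma tensor_add0 : left_id tensor_zero tensor_add.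
Proof.
by move=> u; apply: tensor_ext => C psi archC bim; rewrite tensor_evalD// tensor_eval0// add0r.
Qed.

Lemma tensor_addN : left_inverse tensor_zero tensor_opp tensor_add.
Proof.
by move=> u; apply: tensor_ext => C psi archC bim; rewrite tensor_evalD// tensor_evalN// tensor_eval0// addNr.
Qed.

HB.instance Definition _ := GRing.isZmodule.Build riesz_tensor
  tensor_addA tensor_addC tensor_add0 tensor_addN.

Lemma tensor_scaleA a b u :
  tensor_scale a (tensor_scale b u) = tensor_scale (a * b) u.
Proof.
by apply: tensor_ext => C psi archC bim; rewrite !tensor_evalZ// scalerA.
Qed.

Lemma tensor_scale1 : left_id 1 tensor_scale.
Proof.
by move=> u; apply: tensor_ext => C psi archC bim; rewrite tensor_evalZ// scale1r.
Qed.

Lemma tensor_scaleDr : right_distributive tensor_scale (@GRing.add riesz_tensor).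
Proof.
by move=> c u v; apply: tensor_ext => C psi archC bim; rewrite !(tensor_evalD, tensor_evalZ)// scalerDr.
Qed.

Lemma tensor_scaleDl u : {morph tensor_scale^~ u : a b / a + b}.
Proof.
by move=> a b; apply: tensor_ext => C psi archC bim; rewrite !(tensor_evalD, tensor_evalZ)// scalerDl.
Qed.

HB.instance Definition _ := GRing.Zmodule_isLmodule.Build R riesz_tensor
  tensor_scaleA tensor_scale1 tensor_scaleDr tensor_scaleDl.

Lemma tensor_le_refl : reflexive tensor_le.
Proof. by move=> u; apply/asboolP => *; exact: vle_refl. Qed.

Lemma tensor_le_anti : antisymmetric tensor_le.
Proof.
move=> u v /andP[/asboolP uv /asboolP vu]; apply: tensor_ext => C psi archC bim.
by apply: vle_eq; [exact: uv | exact: vu].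
Qed.

Lemma tensor_le_trans : transitive tensor_le.
Proof.
move=> v u w /asboolP uv /asboolP vw; apply/asboolP => C psi archC bim.
by apply: (vle_le_trans (uv _ _ archC bim)); exact: vw.
Qed.

Lemma tensor_join_le u v w :
  tensor_le (tensor_join u v) w = tensor_le u w && tensor_le v w.
Proof.
apply/asboolP/andP => [h|[/asboolP uw /asboolP vw] C psi archC bim].
  by split; apply/asboolP => C psi archC bim; have := h _ _ archC bim;
    rewrite tensor_evalJ// vjoin_le => /andP[].
by rewrite tensor_evalJ// vjoin_le uw ?vw.
Qed.

Lemma tensor_le_meet u v w :
  tensor_le w (tensor_meet u v) = tensor_le w u && tensor_le w v.
Proof.
apply/asboolP/andP => [h|[/asboolP uw /asboolP vw] C psi archC bim].
  by split; apply/asboolP => C psi archC bim; have := h _ _ archC bim;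
    rewrite tensor_evalM// vle_meet => /andP[].
by rewrite tensor_evalM// vle_meet uw ?vw.
Qed.

Lemma tensor_le_add2r (w u v : riesz_tensor) : tensor_le u v -> tensor_le (u + w) (v + w).
Proof.
move=> /asboolP uv; apply/asboolP => C psi archC bim.
by rewrite !tensor_evalD//; apply: vle_addr2; exact: uv.
Qed.

Lemma tensor_scale_ge0 (a : R) (u : riesz_tensor) :
  0 <= a -> tensor_le 0 u -> tensor_le 0 (a *: u).
Proof.
move=> a0 /asboolP u0; apply/asboolP => C psi archC bim.
have := u0 _ _ archC bim; rewrite tensor_evalZ// tensor_eval0//.
exact: vscale_ge0.
Qed.

HB.instance Definition _ := Lmodule_isVectorLattice.Build R riesz_tensor
  tensor_le_refl tensor_le_anti tensor_le_trans tensor_join_le tensor_le_meet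
  tensor_le_add2r tensor_scale_ge0.

Definition tensor (a : A) (b : B) : riesz_tensor := tensor_pi (TTens a b).

Lemma tensor_eval_hom (C : vectorLatticeType R) (psi : A -> B -> C) :
  archimedean_lattice C -> riesz_bimorphism psi ->
  riesz_homomorphism (tensor_eval psi).
Proof.
move=> archC bim; split=> [c u v|u v|u v].
- by rewrite tensor_evalD// tensor_evalZ.
- exact: tensor_evalJ.
- exact: tensor_evalM.
Qed.

Lemma tensor_eval_tensor (C : vectorLatticeType R) (psi : A -> B -> C) a b :
  archimedean_lattice C -> riesz_bimorphism psi ->
  tensor_eval psi (tensor a b) = psi a b.
Proof. by move=> archC bim; rewrite tensor_evalE. Qed.

Lemma tensor_ind (Q : riesz_tensor -> Prop) :
  (forall a b, Q (tensor a b)) ->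
  (forall u v, Q u -> Q v -> Q (u + v)) ->
  (forall c u, Q u -> Q (c *: u)) ->
  (forall u v, Q u -> Q v -> Q (vjoin u v)) ->
  (forall u v, Q u -> Q v -> Q (vmeet u v)) ->
  forall u, Q u.
Proof.
move=> Qt QD QZ QJ QM u; rewrite -[u](@reprK _ {eq_quot term_equiv}).
elim: (repr _) => [a b|s Qs t Qt'|c t Qt'|s Qs t Qt'|s Qs t Qt'].
- exact: Qt.
- suff -> : \pi_{eq_quot term_equiv} (TAdd s t) = tensor_pi s + tensor_pi t by exact: QD.
  by apply: tensor_ext => C psi archC bim; rewrite tensor_evalD// !tensor_evalE.
- suff -> : \pi_{eq_quot term_equiv} (TScale c t) = c *: tensor_pi t by exact: QZ.
  by apply: tensor_ext => C psi archC bim; rewrite tensor_evalZ// !tensor_evalE.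
- suff -> : \pi_{eq_quot term_equiv} (TJoin s t) = vjoin (tensor_pi s) (tensor_pi t) by exact: QJ.
  by apply: tensor_ext => C psi archC bim; rewrite tensor_evalJ// !tensor_evalE.
- suff -> : \pi_{eq_quot term_equiv} (TMeet s t) = vmeet (tensor_pi s) (tensor_pi t) by exact: QM.
  by apply: tensor_ext => C psi archC bim; rewrite tensor_evalM// !tensor_evalE.
Qed.

Lemma tensor_archimedean : archimedean_lattice riesz_tensor.
Proof.
move=> u v /asboolP u0 uv; apply: tensor_ext => C psi archC bim.
rewrite tensor_eval0//; apply: (archC _ (tensor_eval psi v)).
  by have := u0 _ _ archC bim; rewrite tensor_eval0.
move=> n; have /asboolP/(_ _ _ archC bim) := uv n.
suff -> : tensor_eval psi (u *+ n) = tensor_eval psi u *+ n by [].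
elim: n => [|n IH]; first by rewrite !mulr0n tensor_eval0.
by rewrite !mulrS tensor_evalD// IH.
Qed.

Lemma tensor_bimorphism : riesz_bimorphism tensor.
Proof.
have lin1 a : linear (tensor a).
  move=> c b b'; apply: tensor_ext => C psi archC bim.
  rewrite tensor_evalD// tensor_evalZ// !tensor_eval_tensor//.
  by case: bim => lin _ _ _; exact: lin.
have lin2 b : linear (tensor^~ b).
  move=> c a a'; apply: tensor_ext => C psi archC bim.
  rewrite tensor_evalD// tensor_evalZ// !tensor_eval_tensor//.
  by case: bim => _ lin _ _; exact: (lin b).
split=> // [a a0|b b0]; split=> // u v; apply: tensor_ext => C psi archC bim;
  rewrite ?tensor_evalJ ?tensor_evalM// !tensor_eval_tensor//.
- by case: bim => _ _ /(_ a a0)[].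
- by case: bim => _ _ /(_ a a0)[].
- by case: bim => _ _ _ /(_ b b0)[].
- by case: bim => _ _ _ /(_ b b0)[].
Qed.

(** Evaluation of terms gives the factorization through the quotient, and
    uniqueness holds because the elementary tensors generate
    ([tensor_ind]). *)
Theorem riesz_tensorP : riesz_tensor_product tensor.
Proof.
split; [exact: tensor_archimedean | exact: tensor_bimorphism |].
move=> C psi archC bim; exists (tensor_eval psi); split.
  by split; [exact: tensor_eval_hom | move=> a b; exact: tensor_eval_tensor].
move=> phi [[lin join meet] phit]; apply/funext; elim/tensor_ind.
- by move=> a b; rewrite phit tensor_eval_tensor.
- move=> u v IHu IHv; rewrite tensor_evalD// IHu IHv.
  by have := lin 1 u v; rewrite !scale1r => ->.
- move=> c u IHu; rewrite tensor_evalZ// IHu.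
  suff phi0 : phi 0 = 0 by have := lin c u 0; rewrite phi0 !addr0 => ->.
  by have := lin (-1) 0 0; rewrite !scaleN1r !addNr.
- by move=> u v IHu IHv; rewrite tensor_evalJ// join IHu IHv.
- by move=> u v IHu IHv; rewrite tensor_evalM// meet IHu IHv.
Qed.

End RieszTensor.

(** * Positive maps, bimorphisms and disjoint families *)

Section LinearHelpers.
Context (R : realType) (V W : lmodType R) (f : V -> W) (linf : linear f).

Lemma linD x y : f (x + y) = f x + f y.
Proof. by have := linf 1 x y; rewrite !scale1r. Qed.

Lemma lin0 : f 0 = 0.
Proof. by have := linf (-1) 0 0; rewrite !scaleN1r !addNr. Qed.

Lemma linZ (c : R) x : f (c *: x) = c *: f x.
Proof. by have := linf c x 0; rewrite lin0 !addr0. Qed.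

Lemma linN x : f (- x) = - f x.
Proof. by rewrite -scaleN1r linZ scaleN1r. Qed.

Lemma linB x y : f (x - y) = f x - f y.
Proof. by rewrite linD linN. Qed.

Lemma lin_sum (K : Type) (r : seq K) (F : K -> V) :
  f (\sum_(k <- r) F k) = \sum_(k <- r) f (F k).
Proof. by elim: r => [|k r IH]; rewrite ?big_nil ?lin0// !big_cons linD IH. Qed.

End LinearHelpers.

Section PositiveMaps.
Context (R : realType).

Lemma vhalf_ge0 (V : vectorLatticeType R) (x : V) : 0 <=v x *+ 2 -> 0 <=v x.
Proof.
have h2 : 0 <= 2^-1 :> R by rewrite invr_ge0 ler0n.
move=> /(vscale_ge0 h2); rewrite -[x *+ 2]scaler_nat scalerA mulVf ?pnatr_eq0//.
by rewrite scale1r.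
Qed.

Context (V W : vectorLatticeType R).

Lemma riesz_hom_le (f : V -> W) x y :
  riesz_homomorphism f -> x <=v y -> f x <=v f y.
Proof.
by move=> [_ fJ _] xy; rewrite -(vjoin_idPr xy) fJ; exact: vle_joinl.
Qed.

Lemma riesz_hom_ge0 (f : V -> W) x :
  riesz_homomorphism f -> 0 <=v x -> 0 <=v f x.
Proof.
move=> fhom x0; have := riesz_hom_le fhom x0.
by case: fhom => lin _ _; rewrite (lin0 lin).
Qed.

Lemma riesz_hom_abs (f : V -> W) x :
  riesz_homomorphism f -> f (vabs x) = vabs (f x).
Proof. by move=> [lin fJ _]; rewrite /vabs fJ (linN lin). Qed.

Lemma positive_linear_le (f : V -> W) x y : linear f ->
  (forall z, 0 <=v z -> 0 <=v f z) -> x <=v y -> f x <=v f y.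
Proof. by move=> lin f0 xy; rewrite -vsubr_ge0 -(linB lin) f0// vsubr_ge0. Qed.

Lemma positive_linear_abs (f : V -> W) x : linear f ->
  (forall z, 0 <=v z -> 0 <=v f z) -> vabs (f x) <=v f (vabs x).
Proof.
move=> lin f0; apply: vabs_le; first exact: positive_linear_le (vle_abs _).
by rewrite -(linN lin); exact: positive_linear_le (vle_absN _).
Qed.

End PositiveMaps.

Section Bimorphisms.
Context (R : realType) (V W X : vectorLatticeType R).
Context (m : V -> W -> X) (bim : riesz_bimorphism m).

Let lin1 x : linear (m x). Proof. by case: bim. Qed.
Let lin2 y : linear (m^~ y). Proof. by case: bim. Qed.

Lemma bimorphism_ge0 x y : 0 <=v x -> 0 <=v y -> 0 <=v m x y.
Proof.
move=> x0 y0; rewrite -(lin0 (lin1 x)); apply: riesz_hom_le => //.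
by case: bim => _ _ /(_ x x0).
Qed.

Lemma bimorphism_le x x' y y' :
  0 <=v x -> 0 <=v y -> x <=v x' -> y <=v y' -> m x y <=v m x' y'.
Proof.
move=> x0 y0 xx' yy'; apply: (@vle_le_trans _ _ _ (m x' y)).
  by case: bim => _ _ _ /(_ y y0) h; exact: (riesz_hom_le h xx').
have x'0 : 0 <=v x' := vle_le_trans x0 xx'.
by case: bim => _ _ /(_ x' x'0) h _; exact: (riesz_hom_le h yy').
Qed.

(** Twice the difference of the two sides, with [x] in place of [vabs x] on
    one of them, is
    [m (vabs x - x) (vabs y + y) + m (vabs x + x) (vabs y - y)]. *)
Lemma bimorphism_abs x y : vabs (m x y) <=v m (vabs x) (vabs y).
Proof.
have aux z : m z y <=v m (vabs z) (vabs y).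
  rewrite -vsubr_ge0; apply: vhalf_ge0.
  have -> : (m (vabs z) (vabs y) - m z y) *+ 2 =
      m (vabs z - z) (vabs y + y) + m (vabs z + z) (vabs y - y).
    rewrite (linB (lin2 _)) (linD (lin2 _)) !(linB (lin1 _)) !(linD (lin1 _)).
    set a := m (vabs z) (vabs y); set b := m (vabs z) y; set c := m z (vabs y); set d := m z y.
    rewrite mulr2n addrACA opprD [RHS]addrACA (addrACA a b) subrr addr0.
    by rewrite (addrACA (- c)) addNr add0r.
  have abs_sub (Y : vectorLatticeType R) (t : Y) : 0 <=v vabs t - t.
    by rewrite vsubr_ge0 vle_abs.
  have abs_add (Y : vectorLatticeType R) (t : Y) : 0 <=v vabs t + t.
    by rewrite -[t in _ + t]opprK vsubr_ge0 vle_absN.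
  by apply: vadd_ge0; apply: bimorphism_ge0.
apply: vabs_le => //; rewrite -(linN (lin2 y)); apply: vle_le_trans (aux _) _.
by rewrite vabsN vle_refl.
Qed.

End Bimorphisms.

Section DisjointFamily.
Context (R : realType) (V : vectorLatticeType R) (K : eqType) (d : K -> V).
Hypotheses (d0 : forall k, 0 <=v d k)
           (dd : forall k l, k != l -> vmeet (d k) (d l) = 0).

(** The positive and the negative coefficients give two disjoint elements [p]
    and [n], and [(p - n)^+ = p - vmeet p n]. *)
Lemma disjoint_family_pos (s : seq K) (g : K -> R) :
  vjoin (\sum_(k <- s) g k *: d k) 0 = \sum_(k <- s) Num.max (g k) 0 *: d k.
Proof.
pose p := \sum_(k <- s) Num.max (g k) 0 *: d k.
pose n := \sum_(k <- s) Num.max (- g k) 0 *: d k.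
have g0 k : 0 <= Num.max (g k) 0 by rewrite le_max lexx orbT.
have n0 k : 0 <= Num.max (- g k) 0 by rewrite le_max lexx orbT.
have -> : \sum_(k <- s) g k *: d k = p - n.
  rewrite -sumrB; apply: eq_bigr => k _; rewrite -scalerBl; congr (_ *: _).
  rewrite /Num.max oppr_lt0; case: (ltgtP (g k) 0) => [||->];
  by rewrite ?opprK ?add0r ?subr0 ?oppr0.
rewrite vjoin_sub0; suff -> : vmeet p n = 0 by rewrite subr0.
apply: vmeet_sum_eq0 => [|k|k]; [|exact: vscale_ge0|].
  by apply: vsum_ge0 => k; exact: vscale_ge0.
rewrite vmeetC; apply: vmeet_sum_eq0 => [|l|l]; [exact: vscale_ge0|exact: vscale_ge0|].
have [->|kl] := eqVneq k l; last by rewrite vmeet_scale_eq0 ?dd.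
case/orP: (le_total 0 (g l)) => gl.
  by rewrite [Num.max (- _) _]max_r ?oppr_le0// scale0r vmeet_idPl// vscale_ge0.
by rewrite vmeetC [Num.max (g l) _]max_r// scale0r vmeet_idPl// vscale_ge0.
Qed.

(** On the span of a disjoint family the lattice operations are therefore
    computed coefficientwise. *)
Lemma disjoint_family_join (s : seq K) (g h : K -> R) :
  vjoin (\sum_(k <- s) g k *: d k) (\sum_(k <- s) h k *: d k) =
  \sum_(k <- s) Num.max (g k) (h k) *: d k.
Proof.
rewrite vjoinE -sumrB; under eq_bigr do rewrite -scalerBl.
rewrite disjoint_family_pos -big_split/=; apply: eq_bigr => k _.
by rewrite -scalerDl addr_maxl subrK add0r.
Qed.

Lemma disjoint_family_meet (s : seq K) (g h : K -> R) :
  vmeet (\sum_(k <- s) g k *: d k) (\sum_(k <- s) h k *: d k) =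
  \sum_(k <- s) Num.min (g k) (h k) *: d k.
Proof.
rewrite vmeet_opp -!sumrN.
under eq_bigr do rewrite -scaleNr.
under [X in vjoin _ X]eq_bigr do rewrite -scaleNr.
rewrite disjoint_family_join -sumrN; apply: eq_bigr => k _.
by rewrite -scaleNr oppr_max !opprK.
Qed.

End DisjointFamily.

(** * The Fremlin tensor product of spaces of summable families *)

Section L1Tensor.
Context (R : realType) (I J : eqType).
Local Notation A := (l1 R I).
Local Notation B := (l1 R J).
Local Notation T := (riesz_tensor A B).
Local Notation P := (l1 R (I * J)%type).
Local Notation tens := (@tensor R A B).
Implicit Types (a e : A) (b f : B) (u v : T).

(** The canonical map into the completion; it reads an element of the Riesz
    tensor product as a matrix. *)
Definition l1_embed : T -> P := tensor_eval (@l1_tensor R I J).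
Local Notation j := l1_embed.

Let archP : archimedean_lattice P := @l1_archimedean R _.
Let bimP := @l1_tensor_bimorphism R I J.
Let bimT : riesz_bimorphism tens := @tensor_bimorphism R A B.

Lemma l1_embed_hom : riesz_homomorphism j.
Proof. exact: tensor_eval_hom. Qed.

Lemma l1_embed_tensor a b : j (tens a b) = l1_tensor a b.
Proof. exact: tensor_eval_tensor. Qed.

Lemma l1_embed_linear : linear j.
Proof. by case: l1_embed_hom. Qed.

Let linj := l1_embed_linear.

Lemma tensor_linearr a : linear (tens a). Proof. by case: bimT. Qed.
Lemma tensor_linearl b : linear (tens^~ b). Proof. by case: bimT. Qed.
Let lin1 := tensor_linearr.
Let lin2 := tensor_linearl.

Definition unit_tensor (p : I * J) : T := tens (l1_unit R p.1) (l1_unit R p.2).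

Lemma unit_tensor_ge0 p : 0 <=v unit_tensor p.
Proof. by apply: (bimorphism_ge0 bimT); exact: l1_unit_ge0. Qed.

(** Two distinct pairs differ in a coordinate. Where they differ the units are
    disjoint, and tensoring with one common positive factor is a Riesz
    homomorphism. *)
Lemma unit_tensor_disjoint p q : p != q -> vmeet (unit_tensor p) (unit_tensor q) = 0.
Proof.
move: p q => [i k] [i' k'] /= pq.
apply: vle_eq; last by apply: vmeet_ge0; exact: unit_tensor_ge0.
have u0 := @l1_unit_ge0 R.
have [ii'|ii'] := eqVneq i i'.
  have kk' : k != k' by apply: contraNneq pq => ->; rewrite ii'.
  have [_ _ meet] : riesz_homomorphism (tens (l1_unit R i)).
    by case: bimT => _ _ /(_ _ (u0 _ i)).
  by rewrite /unit_tensor/= -ii' -meet l1_unit_disjoint// (lin0 (lin1 _)) vle_refl.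
pose f := l1_unit R k + l1_unit R k' : B.
have f0 : 0 <=v f by apply: vadd_ge0; exact: u0.
have [_ _ meet] : riesz_homomorphism (tens^~ f) by case: bimT => _ _ _ /(_ _ f0).
rewrite -(lin0 (lin2 f)) -(l1_unit_disjoint R ii') meet.
apply: vmeet_le2; apply: (bimorphism_le bimT); rewrite ?u0 ?vle_refl//.
  by rewrite /f -vsubr_ge0 addrAC subrr add0r u0.
by rewrite /f -vsubr_ge0 addrK u0.
Qed.

Definition finite_part (s : seq I) (r : seq J) u : T :=
  \sum_(p <- [seq (i, k) | i <- s, k <- r]) j u p *: unit_tensor p.

Lemma finite_part_tensor s r a b :
  finite_part s r (tens a b) = tens (l1_trunc s a) (l1_trunc r b).
Proof.
rewrite /finite_part big_allpairs/= (lin_sum (lin2 _)); apply: eq_bigr => i _.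
rewrite (lin_sum (lin1 _)); apply: eq_bigr => k _.
by rewrite l1_embed_tensor l1_tensorE (linZ (lin2 _)) (linZ (lin1 _)) scalerA mulrC.
Qed.

Definition tensor_tail s r e f : T :=
  tens (e - l1_trunc s e) f + tens e (f - l1_trunc r f).

Lemma l1_truncD (K : eqType) (s : seq K) (x y : l1 R K) :
  l1_trunc s (x + y) = l1_trunc s x + l1_trunc s y.
Proof. by rewrite -big_split; apply: eq_bigr => i _; rewrite l1D scalerDl. Qed.

Lemma l1_truncZ (K : eqType) (s : seq K) (c : R) (x : l1 R K) :
  l1_trunc s (c *: x) = c *: l1_trunc s x.
Proof. by rewrite scaler_sumr; apply: eq_bigr => i _; rewrite l1Z scalerA. Qed.

Lemma tensor_tail_add s r e f e' f' : uniq s -> uniq r ->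
  0 <=v e -> 0 <=v f -> 0 <=v e' -> 0 <=v f' ->
  tensor_tail s r e f + tensor_tail s r e' f' <=v
  tensor_tail s r (e + e') (f + f').
Proof.
move=> us ur e0 f0 e'0 f'0; rewrite /tensor_tail addrACA; apply: vle_add.
  rewrite l1_truncD opprD addrACA (linD (lin2 (f + f'))); apply: vle_add.
    rewrite (linD (lin1 _)) -vsubr_ge0 addrAC subrr add0r.
    by apply: (bimorphism_ge0 bimT) => //; exact: l1_tail_ge0.
  rewrite (linD (lin1 _)) -vsubr_ge0 addrK.
  by apply: (bimorphism_ge0 bimT) => //; exact: l1_tail_ge0.
rewrite l1_truncD opprD [X in _ <=v tens _ X]addrACA (linD (lin1 (e + e'))).
apply: vle_add.
  rewrite (linD (lin2 _)) -vsubr_ge0 addrAC subrr add0r.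
  by apply: (bimorphism_ge0 bimT) => //; exact: l1_tail_ge0.
rewrite (linD (lin2 _)) -vsubr_ge0 addrK.
by apply: (bimorphism_ge0 bimT) => //; exact: l1_tail_ge0.
Qed.

Definition approximable u : Prop := exists e f, [/\ 0 <=v e, 0 <=v f &
  forall s r, uniq s -> uniq r ->
    vabs (u - finite_part s r u) <=v tensor_tail s r e f].

(** Every element of the Riesz tensor product is finite up to elementary
    tensors of small tails. This is clear for an elementary tensor. The two
    lattice operations preserve it: they are Lipschitz, and they commute with
    [finite_part] because the tensors of units are disjoint. *)
Lemma finite_part_approx u : approximable u.
Proof.
have lift2 (op : T -> T -> T) : (forall s r x y, finite_part s r (op x y) =
      op (finite_part s r x) (finite_part s r y)) ->
    (forall x y z t, vabs (op x y - op z t) <=v vabs (x - z) + vabs (y - t)) ->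
    forall v w : T,
    approximable v ->
    approximable w ->
    approximable (op v w).
  move=> opF op_lip v w [e [f [e0 f0 He]]] [e' [f' [e'0 f'0 He']]].
  exists (e + e'), (f + f'); split; [exact: vadd_ge0|exact: vadd_ge0|].
  move=> s r us ur; rewrite opF; apply: (vle_le_trans (op_lip _ _ _ _)).
  apply: (@vle_le_trans _ _ _ (tensor_tail s r e f + tensor_tail s r e' f')).
    by apply: vle_add; [exact: He | exact: He'].
  exact: tensor_tail_add.
elim/tensor_ind: u => [a b||c v [e [f [e0 f0 He]]]||].
- exists (vabs a), (vabs b); split; [exact: vabs_ge0|exact: vabs_ge0|].
  move=> s r us ur; rewrite finite_part_tensor.
  have -> : tens a b - tens (l1_trunc s a) (l1_trunc r b) =
      tens (a - l1_trunc s a) b + tens (l1_trunc s a) (b - l1_trunc r b).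
    by rewrite (linB (lin2 _)) (linB (lin1 _)) addrA subrK.
  apply: (vle_le_trans (vabs_add _ _)); apply: vle_add.
    by rewrite -l1_tail_abs//; exact: (bimorphism_abs bimT).
  rewrite -(l1_tail_abs b ur); apply: (vle_le_trans (bimorphism_abs bimT _ _)).
  apply: (bimorphism_le bimT); rewrite ?vabs_ge0 ?vle_refl//.
  apply/l1_vleP => i; rewrite !l1_vabsE l1_truncE//.
  by case: ifP; rewrite ?normr0.
- apply: lift2 => [s r x y|x y z t].
    rewrite /finite_part -big_split; apply: eq_bigr => p _.
    by rewrite (linD linj) l1D scalerDl.
  by rewrite opprD addrACA vabs_add.
- exists (`|c| *: e), f; split; [exact: vscale_ge0|exact: f0|] => s r us ur.
  have -> : c *: v - finite_part s r (c *: v) = c *: (v - finite_part s r v).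
    rewrite scalerBr scaler_sumr; congr (_ - _); apply: eq_bigr => p _.
    by rewrite (linZ linj) l1Z scalerA.
  apply: (vle_le_trans (vabs_scale _ _)).
  have -> : tensor_tail s r (`|c| *: e) f = `|c| *: tensor_tail s r e f.
    by rewrite /tensor_tail l1_truncZ -scalerBr !(linZ (lin2 _)) scalerDr.
  by apply: vle_scale => //; exact: He.
- apply: lift2 => [s r x y|]; last exact: vabs_join_sub.
  have [_ jJ _] := l1_embed_hom.
  rewrite /finite_part (disjoint_family_join unit_tensor_ge0 unit_tensor_disjoint).
  by apply: eq_bigr => p _; rewrite jJ l1_vjoinE.
- apply: lift2 => [s r x y|]; last exact: vabs_meet_sub.
  have [_ _ jM] := l1_embed_hom.
  rewrite /finite_part (disjoint_family_meet unit_tensor_ge0 unit_tensor_disjoint).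
  by apply: eq_bigr => p _; rewrite jM l1_vmeetE.
Qed.

Lemma tail_norm_small e f (eps : R) : 0 < eps -> exists s r,
  [/\ uniq s, uniq r &
      `|e - l1_trunc s e| * `|f| + `|e| * `|f - l1_trunc r f| <= eps].
Proof.
move=> eps0; pose c : R := `|e| + `|f| + 1.
have c0 : 0 < c by rewrite ltr_wpDl// addr_ge0.
have d0 : 0 < eps / (c *+ 2) by rewrite divr_gt0// pmulrn_lgt0.
have [s us sle] := l1_tail_small e d0; have [r ur rle] := l1_tail_small f d0.
exists s, r; split => //; rewrite (splitr eps).
have -> : eps / 2 = eps / (c *+ 2) * c.
  by field; rewrite gt_eqF.
apply: lerD; last rewrite mulrC; apply: ler_pM => //;
by rewrite /c -addrA ?lerDl ?addr_ge0// addrC -addrA lerDl addr_ge0.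
Qed.

Section PositiveMapsOnTensors.
Context (W : banachLatticeType R) (c : R).
Implicit Type L : T -> W.

(** The bound on elementary tensors controls both maps on [tensor_tail], hence
    on [u - finite_part s r u], and on [finite_part s r u] they agree. *)
Lemma positive_maps_eq L L' : 0 <= c -> linear L -> linear L' ->
  (forall v, 0 <=v v -> 0 <=v L v) -> (forall v, 0 <=v v -> 0 <=v L' v) ->
  (forall a b, L (tens a b) = L' (tens a b)) ->
  (forall a b, 0 <=v a -> 0 <=v b -> `|L (tens a b)| <= c * (`|a| * `|b|)) ->
  L =1 L'.
Proof.
move=> c0 linL linL' L0 L'0 LL' Lc u; apply/eqP; rewrite -subr_eq0 -normr_le0.
apply/ler_addgt0Pr => eps eps0; rewrite add0r.
have [e [f [e0 f0 uef]]] := finite_part_approx u.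
have d0 : 0 < eps / ((c + 1) *+ 2) by rewrite divr_gt0// pmulrn_lgt0// ltr_wpDl.
have [s [r [us ur small]]] := tail_norm_small e f d0.
have close M : linear M -> (forall v, 0 <=v v -> 0 <=v M v) ->
    (forall a b, L (tens a b) = M (tens a b)) ->
    `|M u - M (finite_part s r u)| <= eps / 2.
  move=> linM M0 LM; rewrite -(linB linM).
  apply: (@le_trans _ _ `|M (tensor_tail s r e f)|).
    apply: lattice_normP; apply: (vle_le_trans (positive_linear_abs _ linM M0)).
    apply: (@vle_le_trans _ _ _ (M (tensor_tail s r e f))) (vle_abs _).
    by apply: (positive_linear_le linM M0); exact: uef.
  rewrite (linD linM) -!LM; apply: (le_trans (ler_normD _ _)).
  have te := l1_tail_ge0 us e0; have tf := l1_tail_ge0 ur f0.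
  apply: (le_trans (lerD (Lc _ _ te f0) (Lc _ _ e0 tf))).
  rewrite -mulrDr; apply: (le_trans (ler_wpM2l c0 small)).
  have c1 : 0 < c + 1 by rewrite ltr_wpDl.
  have -> : c * (eps / ((c + 1) *+ 2)) = eps / 2 * (c / (c + 1)).
    by field; rewrite gt_eqF.
  by rewrite ler_piMr ?divr_ge0 ?(ltW eps0)// ler_pdivrMr// mul1r lerDl.
have fin : L (finite_part s r u) = L' (finite_part s r u).
  rewrite (lin_sum linL) (lin_sum linL'); apply: eq_bigr => p _.
  by rewrite (linZ linL) (linZ linL') LL'.
have -> : L u - L' u = (L u - L (finite_part s r u)) - (L' u - L' (finite_part s r u)).
  by rewrite fin opprB addrA subrK.
rewrite (splitr eps); apply: (le_trans (ler_normB _ _)); apply: lerD; first exact: close.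
by apply: close.
Qed.

End PositiveMapsOnTensors.

Lemma norm_sum_tensor_le (n : nat) (x : 'I_n -> A) (y : 'I_n -> B) :
  `|\sum_(i < n) l1_tensor (x i) (y i)| <= \sum_(i < n) `|x i| * `|y i|.
Proof.
apply: (le_trans (ler_norm_sum _ _ _)); apply: ler_sum => i _.
exact: norm_l1_tensor.
Qed.

(** Any competitor in the infimum dominates [j u] in the space of summable
    matrices, which gives one inequality. For the other, the finite part and
    the tail of [u] supply a competitor [l] whose value exceeds the norm of
    [j u] by at most [eps]. *)
Lemma norm_l1_embed u : `|j u| = positive_projective_norm tens u.
Proof.
rewrite /positive_projective_norm; set S := [set r | _].
have Slb : lbound S `|j u|.
  move=> _ [n [x [y [x0 y0 uxy ->]]]]; apply: le_trans (norm_sum_tensor_le x y).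
  apply: lattice_normP; rewrite -(riesz_hom_abs _ l1_embed_hom).
  apply: vle_le_trans (riesz_hom_le l1_embed_hom uxy) _.
  rewrite (lin_sum linj); under eq_bigr do rewrite l1_embed_tensor.
  exact: vle_abs.
have Sapprox (eps : R) : 0 < eps -> exists2 t, S t & t <= `|j u| + eps.
  move=> eps0; have [e [f [e0 f0 uef]]] := finite_part_approx u.
  have [s [r [us ur small]]] := tail_norm_small e f eps0.
  pose q := [seq (i, k) | i <- s, k <- r].
  pose l : seq (A * B) := [:: (e - l1_trunc s e, f), (e, f - l1_trunc r f) &
    [seq (`|j u p| *: l1_unit R p.1, l1_unit R p.2) | p <- q]].
  have lE (X : nmodType) (F : A * B -> X) :
      \sum_(i < size l) F (nth (0, 0) l i) = \sum_(p <- l) F p.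
    by rewrite (big_nth (0, 0)) big_mkord.
  exists (\sum_(p <- l) `|p.1| * `|p.2|).
    exists (size l), (fun i => (nth (0, 0) l i).1), (fun i => (nth (0, 0) l i).2).
    have l0 : all (fun p => (0 <=v p.1) && (0 <=v p.2)) l.
      rewrite /= !l1_tail_ge0// e0 f0/=; apply/allP => _ /mapP[p _ ->]/=.
      by rewrite vscale_ge0 ?l1_unit_ge0.
    split.
    - by move=> i; have /allP/(_ _ (mem_nth (0,0) (ltn_ord i)))/andP[] := l0.
    - by move=> i; have /allP/(_ _ (mem_nth (0,0) (ltn_ord i)))/andP[] := l0.
    - rewrite (lE _ (fun p => tens p.1 p.2)) !big_cons/= big_map/= addrA.
      rewrite -[u in vabs u](subrK (finite_part s r u)).
      apply: (vle_le_trans (vabs_add _ _)); apply: vle_add; first exact: uef.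
      apply: (vle_le_trans (vabs_sum _ _)); apply: vle_sum => p.
      apply: (vle_le_trans (vabs_scale _ _)).
      by rewrite vabs_ge0_id ?unit_tensor_ge0// (linZ (lin2 _)) vle_refl.
    - by rewrite (lE _ (fun p => `|p.1| * `|p.2|)).
  rewrite !big_cons/= big_map/= addrA addrC; apply: lerD small.
  have uq : uniq q by apply: allpairs_uniq => // -[? ?] [].
  apply: le_trans (l1_norm_ge (j u) uq); apply: ler_sum => p _.
  rewrite normrZ normr_id -[leRHS]mulr1 -[leRHS]mulr1.
  by apply: ler_pM; rewrite ?mulr_ge0// ?ler_pM// norm_l1_unit.
have S0 : S !=set0 by have [t St _] := Sapprox 1 ltr01; exists t.
apply/le_anti/andP; split; first exact: lb_le_inf.
apply/ler_addgt0Pr => eps eps0; have [t St tle] := Sapprox _ eps0.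
by apply: le_trans tle; apply: ge_inf St; exists `|j u|.
Qed.

Lemma l1_embed_dense : dense (range j).
Proof.
move=> O [p Op] oO.
have /nbhs_ballP[eps /= eps0 ballO] := open_nbhs_nbhs (conj oO Op).
have e2 : 0 < eps / 2 by rewrite divr_gt0.
have [s us sle] := l1_tail_small p e2.
exists (l1_trunc s p); split.
  apply: ballO; rewrite -ball_normE /=; apply: le_lt_trans sle _.
  by rewrite ltr_pdivrMr// ltr_pMr// ltr1n.
exists (\sum_(k <- s) p k *: unit_tensor k) => //.
rewrite (lin_sum linj); apply: eq_bigr => -[i k] _.
by rewrite (linZ linj) l1_embed_tensor l1_tensor_unit.
Qed.

Theorem l1_fremlin_tensor : fremlin_projective_tensor_product tens j.
Proof.
split; [exact: riesz_tensorP | exact: l1_embed_hom | exact: norm_l1_embed |].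
exact: l1_embed_dense.
Qed.

End L1Tensor.

(** * Diagonal multiplications *)

Section DiagonalKernel.
Context (R : realType).

(** The data of a multiplication on [l1 R I] in which the square of the unit at
    [i] is [dk_val i], cut off to the [k] with [i] in [dk_dom k], and products
    of distinct units vanish. The lists [dk_dom k] make each coordinate of a
    product a finite sum, and [dk_diag] is the associativity of products of
    units. *)
Record diag_kernel (I : eqType) := DiagKernel {
  dk_dom : I -> seq I;
  dk_val : I -> l1 R I;
  dk_uniq : forall k, uniq (dk_dom k);
  dk_ge0 : forall i, 0 <=v dk_val i;
  dk_norm : forall i, `|dk_val i| <= 1;
  dk_diag : forall i j k, i != j -> dk_val i j * dk_val j k = 0
}.

Section Multiplication.
Context (I : eqType) (K : diag_kernel I).
Local Notation D := (dk_dom K).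
Local Notation a := (dk_val K).
Implicit Types (x y z : l1 R I) (s : seq I).

Definition kernel_fun x y (k : I) : R := \sum_(i <- D k) x i * y i * a i k.

Let a0 i k : 0 <= a i k. Proof. by have /l1_vleP/(_ k) := dk_ge0 K i. Qed.

(** Exchanging the two sums leaves the coefficient sum of [dk_val i] as the
    factor of [`|x i * y i|], and that factor is at most 1. *)
Lemma kernel_sum_le x y s : uniq s ->
  \sum_(k <- s) `|kernel_fun x y k| <= `|x| * `|y|.
Proof.
move=> us; pose U := undup (flatten [seq D k | k <- s]).
apply: (@le_trans _ _ (\sum_(k <- s) \sum_(i <- U) `|x i * y i| * a i k)).
  rewrite big_seq [leRHS]big_seq; apply: ler_sum => k ks.
  apply: (@le_trans _ _ (\sum_(i <- D k) `|x i * y i| * a i k)).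
    apply: (le_trans (ler_norm_sum _ _ _)); apply: ler_sum => i _.
    by rewrite normrM (ger0_norm (a0 _ _)).
  apply: sum_sub_le; rewrite ?dk_uniq ?undup_uniq//; last by move=> i; rewrite mulr_ge0.
  by move=> i iD; rewrite mem_undup; apply/flattenP; exists (D k) => //; exact: map_f.
rewrite exchange_big/=; apply: (@le_trans _ _ (\sum_(i <- U) `|x| * `|y i|)).
  apply: ler_sum => i _; rewrite -mulr_sumr normrM -[leRHS]mulr1.
  rewrite ler_pM ?mulr_ge0 ?sumr_ge0// ?ler_wpM2r ?l1_coord_le//.
  apply: le_trans (dk_norm K i); apply: le_trans (l1_norm_ge _ us).
  by apply: ler_sum => k _; exact: ler_norm.
by rewrite -mulr_sumr ler_wpM2l// l1_norm_ge// undup_uniq.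
Qed.

Lemma kernel_pred x y : kernel_fun x y \in @l1_pred R I.
Proof. by apply/l1_predP; exists (`|x| * `|y|) => s; exact: kernel_sum_le. Qed.

Definition kernel_mul x y : l1 R I := L1 (kernel_pred x y).

Lemma kernel_mulE x y k :
  kernel_mul x y k = \sum_(i <- D k) x i * y i * a i k.
Proof. by []. Qed.

Lemma kernel_mulC : commutative kernel_mul.
Proof.
by move=> x y; apply: l1P => k; apply: eq_bigr => i _; rewrite [x i * _]mulrC.
Qed.

(** In both products the coefficient [a i j * a j k] multiplies three factors
    with indices [i] and [j] only; it vanishes unless these are equal, and then
    the factors can be permuted. *)
Lemma kernel_mulA : associative kernel_mul.
Proof.
move=> x y z; rewrite kernel_mulC; apply: l1P => k; rewrite !kernel_mulE.
apply: eq_bigr => j _; rewrite !kernel_mulE !mulr_suml; apply: eq_bigr => i _.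
have [->|ij] := eqVneq i j; first by ring.
by rewrite -!mulrA ![a i j * (_ * _)]mulrCA dk_diag// !mulr0.
Qed.

Lemma kernel_mul_linear x : linear (kernel_mul x).
Proof.
move=> c y z; apply: l1P => k; rewrite !(kernel_mulE, l1E) mulr_sumr -big_split/=.
by apply: eq_bigr => i _; rewrite !l1E; ring.
Qed.

Lemma kernel_mul_lattice_ordered : lattice_ordered_algebra kernel_mul.
Proof.
split; [exact: kernel_mulA | exact: kernel_mul_linear | |].
  by move=> y c x z; rewrite !(kernel_mulC _ y) kernel_mul_linear.
move=> x y /l1_vleP x0 /l1_vleP y0; apply/l1_vleP => k.
by rewrite kernel_mulE sumr_ge0// => i _; rewrite !mulr_ge0 ?x0 ?y0.
Qed.

Lemma kernel_mul_submultiplicative :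
  submultiplicative kernel_mul (fun x => `|x|).
Proof. by move=> x y; apply: l1_norm_le => s; exact: kernel_sum_le. Qed.

Lemma l1_lattice_norm_norm : lattice_norm (fun x : l1 R I => `|x|).
Proof.
split; [exact: normr0_eq0 | exact: normrZ | exact: ler_normD |].
exact: lattice_normP.
Qed.

Lemma kernel_mul_disjoint x y : disjoint_elements x y -> kernel_mul x y = 0.
Proof.
move=> xy; apply: l1P => k; rewrite kernel_mulE big1// => i _.
have : vmeet (vabs x) (vabs y) i = 0 by rewrite [vmeet _ _]xy.
rewrite l1_vmeetE !l1_vabsE /Num.min.
by case: ifP => _ /eqP; rewrite normr_eq0 => /eqP->; rewrite ?(mul0r, mulr0).
Qed.

Lemma kernel_banach_almost_f : banach_almost_f_algebra kernel_mul.
Proof.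
split; [split | exact: l1_lattice_norm_norm | exact: kernel_mul_submultiplicative].
  exact: kernel_mul_lattice_ordered.
exact: kernel_mul_disjoint.
Qed.

End Multiplication.

Section ProductKernel.
Context (I J : eqType) (K : diag_kernel I) (L : diag_kernel J).

Let dom (p : I * J) := [seq (i, j) | i <- dk_dom K p.1, j <- dk_dom L p.2].
Let val (p : I * J) := l1_tensor (dk_val K p.1) (dk_val L p.2).

Let dom_uniq p : uniq (dom p).
Proof. by apply: allpairs_uniq; rewrite ?dk_uniq// => -[? ?] []. Qed.

Let val_ge0 p : 0 <=v val p.
Proof. by apply: (bimorphism_ge0 (@l1_tensor_bimorphism R I J)); exact: dk_ge0. Qed.

Let val_norm p : `|val p| <= 1.
Proof.
apply: (le_trans (norm_l1_tensor _ _)).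
by rewrite -[leRHS]mulr1 ler_pM// dk_norm.
Qed.

Let val_diag p q r : p != q -> val p q * val q r = 0.
Proof.
case: p q r => [i j] [i' j'] [i'' j''] pq; rewrite !l1_tensorE mulrACA/=.
have [ii'|?] := eqVneq i i'; last by rewrite dk_diag ?mul0r.
rewrite [X in _ * X]dk_diag ?mulr0//; apply: contraNneq pq => ->.
by rewrite ii'.
Qed.

(** The projective tensor product of two such algebras is an algebra of the
    same kind, over the product of the index sets. *)
Definition product_kernel : diag_kernel (I * J)%type :=
  DiagKernel dom_uniq val_ge0 val_norm val_diag.

Lemma product_kernel_mul :
  tensor_multiplication (kernel_mul K) (kernel_mul L) (@l1_tensor R I J)
    (kernel_mul product_kernel).
Proof.
move=> x y z w; apply: l1P => -[k l].
rewrite l1_tensorE !kernel_mulE big_allpairs/= big_distrlr/=.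
by apply: eq_bigr => i _; apply: eq_bigr => j _; rewrite !l1_tensorE; ring.
Qed.

End ProductKernel.

End DiagonalKernel.

(** * Columns of elements of the Riesz tensor product *)

Section Obstruction.
Context (R : realType) (I J : eqType).
Implicit Types (X Y : seq (l1 R I)) (g h : l1 R I).

Definition in_span X g : Prop :=
  exists c : nat -> R, g = \sum_(0 <= m < size X) c m *: X`_m.

Lemma in_span0 X : in_span X 0.
Proof. by exists (fun=> 0); rewrite big1// => m _; rewrite scale0r. Qed.

Lemma in_spanZ X (c : R) g : in_span X g -> in_span X (c *: g).
Proof.
move=> [d ->]; exists (fun m => c * d m); rewrite scaler_sumr.
by apply: eq_bigr => m _; rewrite scalerA.
Qed.

Lemma in_span_cat X Y g h : in_span X g -> in_span Y h -> in_span (X ++ Y) (g + h).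
Proof.
move=> [c ->] [d ->].
exists (fun m => if (m < size X)%N then c m else d (m - size X)%N).
rewrite size_cat [RHS](big_cat_nat (n := size X)) ?leq_addr//=; congr (_ + _).
  by apply: eq_big_nat => m /andP[_ mX]; rewrite nth_cat mX.
rewrite [RHS](big_addn 0 _ (size X)) addKn; apply: eq_bigr => m _.
by rewrite nth_cat ltnNge leq_addl/= addnK.
Qed.

Lemma in_spanl X Y g : in_span X g -> in_span (X ++ Y) g.
Proof. by move=> gX; rewrite -[g]addr0; exact: in_span_cat (in_span0 Y). Qed.

Lemma in_spanr X Y g : in_span Y g -> in_span (X ++ Y) g.
Proof. by move=> gY; rewrite -[g]add0r; exact: in_span_cat (in_span0 X) _. Qed.

Definition piecewise_spanned (u : riesz_tensor (l1 R I) (l1 R J)) : Prop :=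
  exists X, forall l : J, exists L : seq (l1 R I),
    (forall g, g \in L -> in_span X g) /\
    forall k : I, exists2 g, g \in L & l1_embed u (k, l) = g k.

(** A column of an elementary tensor is a multiple of its first factor, and the
    maximum or minimum of two numbers is one of them. The order of the
    quantifiers matters: [X] serves all columns at once, while the list of
    pieces may depend on the column. *)
Lemma columns_piecewise u : piecewise_spanned u.
Proof.
have [linj jJ jM] := l1_embed_hom R I J.
have select (op : riesz_tensor (l1 R I) (l1 R J) -> _ -> _) (opR : R -> R -> R) :
    (forall v w p, l1_embed (op v w) p = opR (l1_embed v p) (l1_embed w p)) ->
    (forall s t, opR s t = s \/ opR s t = t) ->
    forall v w, piecewise_spanned v -> piecewise_spanned w ->
      piecewise_spanned (op v w).
  move=> opE opR_sel v w [X HX] [Y HY]; exists (X ++ Y) => l.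
  have [L [LX Lv]] := HX l; have [M [MY Mw]] := HY l.
  exists (L ++ M); split=> [f|k].
    rewrite mem_cat => /orP[fL|fM].
      by apply: in_spanl; exact: LX.
    by apply: in_spanr; exact: MY.
  have [g gL vg] := Lv k; have [h hM wh] := Mw k; rewrite opE vg wh.
  case: (opR_sel (g k) (h k)) => ->.
    by exists g => //; rewrite mem_cat gL.
  by exists h => //; rewrite mem_cat hM orbT.
elim/tensor_ind: u => [a b|u v [X HX] [Y HY]|c u [X HX]||].
- exists [:: a] => l; exists [:: b l *: a]; split=> [g|k].
    rewrite inE => /eqP->; apply: in_spanZ; exists (fun=> 1).
    by rewrite big_nat1 scale1r.
  by exists (b l *: a); rewrite ?inE// l1_embed_tensor l1_tensorE l1Z mulrC.
- exists (X ++ Y) => l; have [L [LX Lu]] := HX l; have [M [MY Mv]] := HY l.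
  exists [seq g + h | g <- L, h <- M]; split=> [f|k].
    move=> /allpairsP[[g h] /= [gL hM ->]].
    by apply: in_span_cat; [exact: LX | exact: MY].
  have [g gL ug] := Lu k; have [h hM vh] := Mv k.
  exists (g + h); first by apply/allpairsP; exists (g, h).
  by rewrite (linD linj) !l1D ug vh.
- exists X => l; have [L [LX Lu]] := HX l; exists [seq c *: g | g <- L].
  split=> [f /mapP[g gL ->]|k]; first by apply: in_spanZ; exact: LX.
  have [g gL ug] := Lu k; exists (c *: g); first exact: map_f.
  by rewrite (linZ linj) !l1Z ug.
- apply: (select _ Num.max) => [v w p|s t]; first by rewrite jJ l1_vjoinE.
  by rewrite /Num.max; case: ifP; [right | left].
- apply: (select _ Num.min) => [v w p|s t]; first by rewrite jM l1_vmeetE.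
  by rewrite /Num.min; case: ifP; [left | right].
Qed.

Lemma in_span_dependent X (g : nat -> l1 R I) :
  (forall l, (l <= size X)%N -> in_span X (g l)) ->
  exists v : 'rV[R]_((size X).+1),
    v != 0 /\ \sum_(l < (size X).+1) v 0 l *: g l = 0.
Proof.
move=> gX; set n := size X.
have /choice[c gc] : forall l : 'I_n.+1, exists c : nat -> R,
    g l = \sum_(0 <= m < n) c m *: X`_m.
  by move=> l; apply: gX; rewrite -ltnS.
pose C : 'M[R]_(n.+1, n) := \matrix_(l, m) c l m.
have kC : kermx C != 0.
  rewrite kermx_eq0 /row_free; apply/eqP => rC.
  by have := rank_leq_col C; rewrite rC ltnn.
exists (nz_row (kermx C)); rewrite nz_row_eq0; split=> //.
set v := nz_row _; have vC : v *m C = 0 by apply/sub_kermxP; exact: nz_row_sub.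
under eq_bigr do rewrite gc big_mkord scaler_sumr.
rewrite exchange_big big1//= => m _.
under eq_bigr do rewrite scalerA; rewrite -scaler_suml.
have := congr1 (fun M : 'rV_n => M 0 m) vC; rewrite !mxE.
under eq_bigr do rewrite mxE; by move=> ->; rewrite scale0r.
Qed.

End Obstruction.

Section Pigeonhole.

Definition infinitely_many (K : nat -> Prop) := forall N, exists2 k, (N <= k)%N & K k.

Lemma infinitely_many_split (T : eqType) (L : seq T) (K : nat -> Prop) (Q : T -> nat -> Prop) :
  infinitely_many K -> (forall k, K k -> exists2 g, g \in L & Q g k) ->
  exists2 g, g \in L & infinitely_many (fun k => K k /\ Q g k).
Proof.
elim: L K => [|g L IH] K Kinf KL.
  by have [k _ /KL[]] := Kinf 0.
have [|ninf] := pselect (infinitely_many (fun k => K k /\ Q g k)).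
  by exists g; rewrite ?mem_head.
have [N HN] : exists N, forall k, (N <= k)%N -> K k -> ~ Q g k.
  move/existsNP: ninf => [N HN]; exists N => k Nk Kk Qk; apply: HN.
  by exists k.
have [M|k [Kk Nk]|h hL hinf] := IH (fun k => K k /\ (N <= k)%N).
- have [k Mk Kk] := Kinf (maxn M N); move: Mk; rewrite geq_max => /andP[Mk Nk].
  by exists k.
- have [h] := KL _ Kk; rewrite inE => /orP[/eqP-> Qgk|hL Qhk]; last by exists h.
  by case: (HN _ Nk Kk Qgk).
- exists h; first by rewrite inE hL orbT.
  by move=> M; have [k Mk [[Kk _] Qk]] := hinf M; exists k.
Qed.

Lemma infinitely_many_seq (K : nat -> Prop) n : infinitely_many K ->
  exists s : seq nat, [/\ uniq s, size s = n & forall k, k \in s -> K k].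
Proof.
move=> Kinf; elim: n => [|n [s [us <- sK]]]; first by exists [::].
have [k Nk Kk] := Kinf (\max_(i <- s) i).+1.
exists (k :: s); split=> //= [|l].
  rewrite us andbT; apply: contraTN Nk => ks; rewrite -leqNgt.
  exact: (@leq_bigmax_seq _ _ xpredT id).
by rewrite inE => /orP[/eqP->|/sK].
Qed.

End Pigeonhole.

(** * The example *)

Section Example.
Context (R : realType).
Local Notation A := (l1 R (nat * bool)%type).
Local Notation B := (l1 R nat).
Local Notation q := (2^-1 : R).

Lemma half_gt0 : 0 < q. Proof. by rewrite invr_gt0 ltr0n. Qed.
Lemma half_lt1 : q < 1. Proof. by rewrite invf_lt1 ?ltr0n// ltr1n. Qed.

Lemma half_expS n : q ^+ n = q ^+ n.+1 *+ 2.
Proof. by rewrite exprS -mulrnAl -[q *+ 2]mulr_natr mulVf ?pnatr_eq0// mul1r. Qed.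

Lemma sum_half_le (s : seq nat) : uniq s -> \sum_(k <- s) q ^+ k <= 2.
Proof.
move=> us; pose n := (\max_(k <- s) k).+1.
have geo m : \sum_(0 <= k < m) q ^+ k = 2 - q ^+ m *+ 2.
  elim: m => [|m IH]; first by rewrite big_nil expr0; ring.
  by rewrite big_nat_recr//= IH (half_expS m); ring.
apply: (@le_trans _ _ (\sum_(0 <= k < n) q ^+ k)).
  apply: sum_sub_le => //; first exact: iota_uniq.
    move=> k ks; rewrite mem_index_iota /= ltnS.
    exact: (@leq_bigmax_seq _ _ xpredT id).
  by move=> k; rewrite exprn_ge0// ltW// half_gt0.
by rewrite geo gerBl mulrn_wge0// exprn_ge0// ltW// half_gt0.
Qed.

Lemma half_power_sum n (s : seq nat) : uniq s ->
  \sum_(k <- s) `|q ^+ (n.+1 * k)%N| <= 2.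
Proof.
move=> us; apply: le_trans (sum_half_le us); apply: ler_sum => k _.
rewrite ger0_norm ?exprn_ge0 ?(ltW half_gt0)//.
by rewrite ler_wiXn2l ?(ltW half_gt0) ?(ltW half_lt1)// leq_pmull.
Qed.

Lemma half_power_pred n : (fun k => q ^+ (n.+1 * k)%N) \in @l1_pred R nat.
Proof. by apply/l1_predP; exists 2 => s; exact: half_power_sum. Qed.

Definition half_power n : B := L1 (half_power_pred n).

Lemma half_powerE n k : half_power n k = q ^+ (n.+1 * k)%N. Proof. by []. Qed.

Lemma norm_half_power n : `|half_power n| <= 2.
Proof. by apply: l1_norm_le => s; exact: half_power_sum. Qed.

Lemma half_power_ge0 n : 0 <=v half_power n.
Proof. by apply/l1_vleP => k; rewrite half_powerE exprn_ge0// ltW// half_gt0. Qed.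

Definition pointwise_kernel : diag_kernel R nat.
Proof.
apply: (@DiagKernel R nat (fun k => [:: k]) (@l1_unit R nat)) => //.
- by move=> i; exact: l1_unit_ge0.
- by move=> i; exact: norm_l1_unit.
- by move=> i j k; rewrite !l1_unitE eq_sym => /negPf->; rewrite mul0r.
Defined.

Definition input (x : B) : A := l1_tensor x (l1_unit R false).
Definition output (x : B) : A := l1_tensor x (l1_unit R true).

Lemma inputE x i o : input x (i, o) = x i * (o == false)%:R. Proof. by []. Qed.
Lemma outputE x i o : output x (i, o) = x i * (o == true)%:R. Proof. by []. Qed.

Lemma input_ge0 x : 0 <=v x -> 0 <=v input x.
Proof.
by move=> x0; apply: (bimorphism_ge0 (@l1_tensor_bimorphism R _ _)) => //; exact: l1_unit_ge0.
Qed.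

(** The indices are inputs [(i, false)] and outputs [(k, true)]. The square of
    the [i]-th input is the sequence of outputs [q * q ^+ (i.+1 * k)], cut off
    to [k >= i], and all other products of units vanish. Products of three
    elements are then 0, which gives associativity. *)
Definition vandermonde_dom (p : nat * bool) : seq (nat * bool) :=
  if p.2 then [seq (i, false) | i <- iota 0 p.1.+1] else [::].

Definition vandermonde_val (p : nat * bool) : A :=
  if p.2 then 0 else output (q *: half_power p.1).

Definition vandermonde_kernel : diag_kernel R (nat * bool)%type.
Proof.
apply: (@DiagKernel R _ vandermonde_dom vandermonde_val).
- case=> k [] //; rewrite /vandermonde_dom map_inj_uniq ?iota_uniq//.
  by move=> i j [].
- case=> i [] //; rewrite /vandermonde_val/= ?vle_refl//.
  apply: (bimorphism_ge0 (@l1_tensor_bimorphism R _ _)); last exact: l1_unit_ge0.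
  by apply: vscale_ge0; [exact: ltW half_gt0 | exact: half_power_ge0].
- case=> i [] //; rewrite /vandermonde_val/= ?normr0//.
  apply: (le_trans (norm_l1_tensor _ _)); rewrite -[leRHS]mulr1.
  apply: ler_pM; rewrite ?norm_l1_unit// normrZ ger0_norm ?(ltW half_gt0)//.
  by rewrite mulrC ler_pdivrMr ?ltr0n// mul1r norm_half_power.
- move=> [i []] [j []] p _; rewrite /vandermonde_val/= ?l10 ?(mul0r, mulr0)//.
  by rewrite outputE mulr0 mul0r.
Defined.

Local Notation mulA := (kernel_mul vandermonde_kernel).
Local Notation mulB := (kernel_mul pointwise_kernel).
Local Notation mulP := (kernel_mul (product_kernel vandermonde_kernel pointwise_kernel)).
Local Notation T := (riesz_tensor A B).
Local Notation tens := (@tensor R A B).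
Local Notation j := (@l1_embed R (nat * bool)%type nat).

Lemma mulP_output (p p' : l1 R ((nat * bool) * nat)%type) k l :
  mulP p p' ((k, true), l) = \sum_(i <- iota 0 k.+1)
    p ((i, false), l) * p' ((i, false), l) * (q * q ^+ (i.+1 * k)%N).
Proof.
rewrite kernel_mulE big_allpairs.
rewrite (_ : dk_dom _ _ = [seq (i, false) | i <- iota 0 k.+1])// big_map.
apply: eq_bigr => i _; rewrite big_seq1/= l1_tensorE /vandermonde_val/=.
by rewrite outputE l1Z half_powerE l1_unitE !eqxx !mulr1.
Qed.

(** With [x = q ^+ i] and [y = q ^+ l], the entry at the input [i] and the
    column [l] is [x * y] times the positive part of [q * x - `|x - y|]. Powers
    of [q] are so far apart that this vanishes off the diagonal
    ([half_separated]). *)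
Definition diagonal : T :=
  vjoin (q *: tens (input (half_power 1)) (half_power 0) -
         vabs (tens (input (half_power 1)) (half_power 0) -
               tens (input (half_power 0)) (half_power 1))) 0.

Definition weight : T := tens (input (half_power 0)) (half_power 0).

Lemma half_separated (i l : nat) : i != l -> q * q ^+ i <= `|q ^+ i - q ^+ l|.
Proof.
have mono m n : (m <= n)%N -> q ^+ n <= q ^+ m.
  by move=> mn; rewrite ler_wiXn2l ?(ltW half_gt0) ?(ltW half_lt1).
have pos n : 0 <= q ^+ n by rewrite exprn_ge0// ltW// half_gt0.
rewrite neq_ltn => /orP[il|li]; last rewrite distrC.
  by apply: le_trans (ler_norm _); have := mono _ _ il; rewrite exprS; lra.
apply: le_trans (ler_norm _); have := mono _ _ li; have := pos l.
by rewrite exprS; lra.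
Qed.

Lemma l1_embed_diagonal i l : j diagonal ((i, false), l) =
  if i == l then q * (q ^+ l) ^+ 3 else 0.
Proof.
have [linj jJ jM] := l1_embed_hom R (nat * bool)%type nat.
rewrite /diagonal jJ (lin0 linj) l1_vjoinE (linB linj) (linZ linj).
rewrite (riesz_hom_abs _ (l1_embed_hom _ _ _)) (linB linj) !l1_embed_tensor.
rewrite !(l1E, l1_vabsE, l1_tensorE) !l1_unitE eqxx !mulr1 !half_powerE.
rewrite !mul1n !(mulnC 2) !exprM.
set x := q ^+ i; set y := q ^+ l.
have x0 : 0 < x by rewrite exprn_gt0// half_gt0.
have y0 : 0 < y by rewrite exprn_gt0// half_gt0.
have -> : x ^+ 2 * y - x * y ^+ 2 = (x * y) * (x - y) by ring.
rewrite normrM (gtr0_norm (mulr_gt0 x0 y0)).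
have -> : q * (x ^+ 2 * y) - x * y * `|x - y| = x * y * (q * x - `|x - y|) by ring.
case: eqP => [il|/eqP il].
  have -> : x = y by rewrite /x il.
  rewrite subrr normr0 subr0 max_l; first by ring.
  by rewrite !mulr_ge0// ?(ltW half_gt0)// ltW.
rewrite max_r// mulr_ge0_le0//; first by rewrite mulr_ge0// ltW.
rewrite subr_le0.
exact: half_separated.
Qed.

Lemma l1_embed_weight i l : j weight ((i, false), l) = q ^+ i * q ^+ l.
Proof.
by rewrite l1_embed_tensor l1_tensorE inputE mulr1 !half_powerE !mul1n.
Qed.

(** The diagonal matrix isolates, in column [l], the square of the [l]-th
    input. *)
Lemma diagonal_mul_weight k l : (l <= k)%N ->
  mulP (j diagonal) (j weight) ((k, true), l) =
  q ^+ 2 * (q ^+ l) ^+ 5 * (q ^+ k) ^+ l.+1.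
Proof.
move=> lk; have lk' : l \in iota 0 k.+1 by rewrite mem_iota ltnS.
rewrite mulP_output (bigD1_seq l lk' (iota_uniq _ _))/=.
rewrite big1 => [|i /negPf il]; last by rewrite l1_embed_diagonal il !mul0r.
rewrite l1_embed_diagonal eqxx l1_embed_weight [(l.+1 * k)%N]mulnC exprM.
by ring.
Qed.

(** Let [X] have [n] elements. On an infinite set of rows each of the columns
    [0, ..., n] coincides with one vector of the span of [X]. These [n + 1]
    vectors are linearly dependent, and the relation between them says that a
    nonzero polynomial vanishes at [q ^+ k] for infinitely many [k]. *)
Lemma diagonal_mul_weight_notin (w : T) :
  mulP (j diagonal) (j weight) <> j w.
Proof.
move=> jw; have [X HX] := columns_piecewise w; pose n := size X.
(* one pigeonhole argument per column, each on the rows left by the previous *)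
have Hcol m : exists K : nat -> Prop, exists g : nat -> A,
    infinitely_many K /\ forall l, (l < m)%N -> in_span X (g l) /\
      forall k, K k -> j w ((k, true), l) = g l (k, true).
  elim: m => [|m [K [g [Kinf Kg]]]].
    by exists (fun=> True), (fun=> 0); split=> // N; exists N.
  have [L [LX Lw]] := HX m.
  have [h hL hinf] := @infinitely_many_split _ L K
    (fun h k => j w ((k, true), m) = h (k, true)) Kinf (fun k _ => Lw (k, true)).
  exists (fun k => K k /\ j w (k, true, m) = h (k, true)).
  exists (fun l => if l == m then h else g l); split=> // l.
  rewrite ltnS leq_eqVlt; case: eqVneq => [->/= _|_ /= lm].
    by split; [exact: LX | move=> k []].
  by have [gX gK] := Kg _ lm; split=> // k [/gK].
have [K [g [Kinf Kg]]] := Hcol n.+1.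
have [v [v0 vg]] : exists v : 'rV[R]_n.+1,
    v != 0 /\ \sum_(l < n.+1) v 0 l *: g l = 0.
  by apply: in_span_dependent => l ln; have [] := Kg l ln.
(* the factor [q ^+ 2 * q ^+ k] common to row [k] is left out of [p] *)
pose p := \poly_(l < n.+1) (v 0 (inord l) * (q ^+ l) ^+ 5).
have proot k : K k -> (n <= k)%N -> root p (q ^+ k).
  move=> Kk nk; apply/rootP; rewrite horner_poly.
  have : (\sum_(l < n.+1) v 0 l *: g l) (k, true) = 0 by rewrite vg l10.
  rewrite l1_sumE => sum0.
  have : q ^+ 2 * q ^+ k * \sum_(l < n.+1) v 0 (inord l) * (q ^+ l) ^+ 5 * (q ^+ k) ^+ l = 0.
    rewrite -[RHS]sum0 mulr_sumr; apply: eq_bigr => l _.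
    have [_ /(_ _ Kk) gk] := Kg l (ltn_ord l).
    rewrite l1Z -gk -jw diagonal_mul_weight ?inord_val ?exprS; last first.
      by apply: leq_trans nk; rewrite -ltnS.
    by ring.
  move/eqP; rewrite !mulf_eq0 !expf_eq0 !(gt_eqF half_gt0) !andbF !orFb.
  by move/eqP.
have p0 : p = 0.
  apply/eqP; apply: contraT => pn0.
  have Kinf' : infinitely_many (fun k => K k /\ (n <= k)%N).
    move=> N; have [k] := Kinf (maxn N n); rewrite geq_max => /andP[Nk nk] Kk.
    by exists k.
  have [s [us ss sK]] := infinitely_many_seq n.+1 Kinf'.
  have : (size [seq q ^+ k | k <- s] < size p)%N.
    apply: max_poly_roots => //.
      by apply/allP => _ /mapP[k /sK[Kk nk] ->]; exact: proot.
    rewrite map_inj_uniq//; apply: ieexprIn; first exact: half_gt0.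
    by rewrite lt_eqF// half_lt1.
  rewrite size_map ss => /leq_trans/(_ (size_poly _ _)).
  by rewrite ltnn.
case/eqP: v0; apply/rowP => l; rewrite mxE.
have := congr1 (fun r : {poly R} => r`_l) p0; rewrite coef_poly ltn_ord coef0 inord_val.
move/eqP; rewrite mulf_eq0 !expf_eq0 (gt_eqF half_gt0) !andbF orbF.
by move/eqP.
Qed.

End Example.

Theorem corollary4p2 (R : realType) :
  exists (A B : banachLatticeType R) (mulA : A -> A -> A) (mulB : B -> B -> B)
         (T : vectorLatticeType R) (tens : A -> B -> T)
         (P : banachLatticeType R) (j : T -> P) (mulP : P -> P -> P),
    [/\ banach_almost_f_algebra mulA,
        banach_almost_f_algebra mulB,
        riesz_tensor_product tens,
        fremlin_projective_tensor_product tens j &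
        banach_lattice_algebra mulP /\
        tensor_multiplication mulA mulB (fun a b => j (tens a b)) mulP] /\
    (* (i) *)
    ~ (exists (mul : T -> T -> T) (N : T -> R),
         tensor_multiplication mulA mulB tens mul /\
         normed_almost_f_algebra mul N) /\
    (* (ii) *)
    ~ (forall u v : T, exists w : T, mulP (j u) (j v) = j w).
Proof.
pose KA := vandermonde_kernel R; pose KB := pointwise_kernel R.
pose KP := product_kernel KA KB.
exists (l1 R (nat * bool)%type), (l1 R nat), (kernel_mul KA), (kernel_mul KB).
exists (riesz_tensor (l1 R (nat * bool)%type) (l1 R nat)), (@tensor R _ _).
exists (l1 R ((nat * bool) * nat)%type), (@l1_embed R _ _), (kernel_mul KP).
have linj := @l1_embed_linear R (nat * bool)%type nat.
have j0 u : 0 <=v u -> 0 <=v l1_embed u.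
  exact: riesz_hom_ge0 (l1_embed_hom _ _ _).
have tensP : tensor_multiplication (kernel_mul KA) (kernel_mul KB)
    (fun a b => l1_embed (tensor a b)) (kernel_mul KP).
  by move=> a b c d /=; rewrite !l1_embed_tensor; exact: product_kernel_mul.
have [mulPA mulPl mulPr mulP0] := kernel_mul_lattice_ordered KP.
split; [split|split].
- exact: kernel_banach_almost_f.
- exact: kernel_banach_almost_f.
- exact: riesz_tensorP.
- exact: l1_fremlin_tensor.
- split=> //; split; first exact: kernel_mul_lattice_ordered.
  exact: kernel_mul_submultiplicative.
(* both maps below send [u] to the product of [u] and [weight]: one multiplies
   in the Riesz tensor product, the other in its completion *)
- move=> [mul [N [mult [[[_ mull mulr mul0] _] _ _]]]].
  apply: (@diagonal_mul_weight_notin R (mul (diagonal R) (weight R))).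
  have h0 n := half_power_ge0 R n.
  have w0 : 0 <=v weight R.
    apply: (bimorphism_ge0 (@tensor_bimorphism _ _ _)) => //.
    exact: input_ge0.
  pose c := `|input (half_power R 0)| * `|half_power R 0|.
  apply/esym; apply: (@positive_maps_eq R _ _ _ c
    (fun u => l1_embed (mul u (weight R)))
    (fun u => kernel_mul KP (l1_embed u) (l1_embed (weight R)))) => //.
  + by rewrite mulr_ge0.
  + by move=> a u v; rewrite mulr linj.
  + by move=> a u v; rewrite linj mulPr.
  + by move=> u u0; apply: j0; exact: mul0.
  + by move=> u u0; apply: mulP0; exact: j0.
  + by move=> a b; rewrite mult -tensP.
  + move=> a b _ _; rewrite mult l1_embed_tensor.
    apply: (le_trans (norm_l1_tensor _ _)).
    apply: (@le_trans _ _ ((`|a| * `|input (half_power R 0)|) * (`|b| * `|half_power R 0|))).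
      by apply: ler_pM => //; exact: kernel_mul_submultiplicative.
    by rewrite mulrACA mulrC.
- move=> closed; have [w jw] := closed (diagonal R) (weight R).
  exact: diagonal_mul_weight_notin jw.
Qed.
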